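(* Let $m=n$ and let ${\bf f}$ be generic, so that $V_{\bf f}$ is finite. Let $x\neq x'$ be two points of $V_{\bf f}$, let $S_x=x-\tfrac12\mathrm{Jac}_{\bf f}(x)\cdot\mathrm{S}^{ed}_{\bf f}$ and $S_{x'}=x'-\tfrac12\mathrm{Jac}_{\bf f}(x')\cdot\mathrm{S}^{ed}_{\bf f}$, and let $\mathrm{bsc}\subset\mathbb{R}^n$ be the bisector hyperplane of $x$ and $x'$ (the set of points equidistant from $x$ and $x'$). Then there is a point $u\in\mathbb{R}^n$ at which the three hypersurfaces $\mathrm{bsc}$, $\partial_{\rm alg}S_x$ and $\partial_{\rm alg}S_{x'}$ meet tangentially.
   Context: ${\bf f}=(f_1,\dots,f_n)$ with $f_i(x)=x^TA_ix+2a_i^Tx+\alpha_i$ ($A_i$ real symmetric $n\times n$, $a_i\in\mathbb{R}^n$, $\alpha_i\in\mathbb{R}$), $V_{\bf f}=\{x\in\mathbb{R}^n:f_i(x)=0\ \forall i\}$, $\mathrm{Jac}_{\bf f}(x)$ the $n\times n$ Jacobian with $(i,j)$ entry $\partial f_j/\partial x_i$, and $\mathrm{S}^{ed}_{\bf f}=\{\lambda\in\mathbb{R}^n:\sum_i\lambda_iA_i\prec I_n\}$. $\partial_{\rm alg}S$ denotes the algebraic boundary (Zariski closure of the topological boundary) of $S$. *)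

(* Defs.v *)
From HB Require Import structures.
From mathcomp Require Import all_boot all_order all_algebra.
From mathcomp Require Import reals.
From mathcomp Require Import mpoly.
Set Implicit Arguments. Unset Strict Implicit. Unset Printing Implicit Defensive.
Import Order.TTheory GRing.Theory Num.Theory.
Local Open Scope ring_scope.

Section Defs.
Variables (R : realType) (n : nat).

Definition coordsv (x : 'cV[R]_n) : 'I_n -> R := fun i => x i ord0.

Definition fpoly (A : 'I_n -> 'M[R]_n) (a : 'I_n -> 'cV[R]_n) (al : 'I_n -> R)
  (i : 'I_n) : {mpoly R[n]} :=
  \sum_(k < n) \sum_(l < n) (A i k l)%:MP * 'X_k * 'X_l
  + \sum_(k < n) (2 * a i k ord0)%:MP * 'X_k + (al i)%:MP.

Definition Vf A a al (x : 'cV[R]_n) : Prop :=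
  forall i, (fpoly A a al i).@[coordsv x] = 0.

Definition Jacf A a al (x : 'cV[R]_n) : 'M[R]_n :=
  \matrix_(i < n, j < n) (mderiv i (fpoly A a al j)).@[coordsv x].

Definition posdef (M : 'M[R]_n) : Prop :=
  forall v : 'cV[R]_n, v != 0 -> 0 < (v^T *m M *m v) ord0 ord0.

Definition Sed (A : 'I_n -> 'M[R]_n) (lam : 'cV[R]_n) : Prop :=
  posdef (1%:M - \sum_(i < n) lam i ord0 *: A i).

Definition Sx A a al (x : 'cV[R]_n) (u : 'cV[R]_n) : Prop :=
  exists2 lam, Sed A lam & u = x - 2^-1 *: (Jacf A a al x *m lam).

Definition sqnorm (v : 'cV[R]_n) : R := \sum_(i < n) v i ord0 ^+ 2.

Definition topbd (S : 'cV[R]_n -> Prop) (u : 'cV[R]_n) : Prop :=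
  forall e : R, 0 < e ->
    (exists v, S v /\ sqnorm (v - u) < e ^+ 2) /\
    (exists w, ~ S w /\ sqnorm (w - u) < e ^+ 2).

Definition vanishes_on (p : {mpoly R[n]}) (S : 'cV[R]_n -> Prop) : Prop :=
  forall v, S v -> p.@[coordsv v] = 0.

Definition zcl (S : 'cV[R]_n -> Prop) (u : 'cV[R]_n) : Prop :=
  forall p : {mpoly R[n]}, vanishes_on p S -> p.@[coordsv u] = 0.

Definition algbd (S : 'cV[R]_n -> Prop) : 'cV[R]_n -> Prop := zcl (topbd S).

Definition tangent_space (Z : 'cV[R]_n -> Prop) (u : 'cV[R]_n) (w : 'cV[R]_n) : Prop :=
  forall p : {mpoly R[n]}, vanishes_on p Z ->
    \sum_(i < n) (mderiv i p).@[coordsv u] * w i ord0 = 0.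

Definition bisector (x x' : 'cV[R]_n) (u : 'cV[R]_n) : Prop :=
  sqnorm (u - x) = sqnorm (u - x').

Definition meet_tangentially (Z1 Z2 Z3 : 'cV[R]_n -> Prop) (u : 'cV[R]_n) : Prop :=
  [/\ Z1 u, Z2 u, Z3 u,
      (forall w, tangent_space Z1 u w <-> tangent_space Z2 u w) &
      (forall w, tangent_space Z1 u w <-> tangent_space Z3 u w)].

End Defs.

Definition coefT (n : nat) : finType :=
  (('I_n * 'I_n * 'I_n) + ('I_n * 'I_n) + 'I_n)%type.

Definition coef_of (R : realType) (n : nat) (A : 'I_n -> 'M[R]_n)
  (a : 'I_n -> 'cV[R]_n) (al : 'I_n -> R) (c : coefT n) : R :=
  match c with
  | inl (inl (i, k, l)) => A i k l
  | inl (inr (i, k)) => a i k ord0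
  | inr i => al i
  end.

Definition coords (R : realType) (n : nat) (A : 'I_n -> 'M[R]_n)
  (a : 'I_n -> 'cV[R]_n) (al : 'I_n -> R) : 'I_#|{: coefT n}| -> R :=
  fun k => coef_of A a al (enum_val k).

(* Main.v *)
Require Import Defs.
From HB Require Import structures.
From mathcomp Require Import all_boot all_order all_algebra.
From mathcomp Require Import perm boolp classical_sets reals.
From mathcomp Require Import mpoly.
From mathcomp Require Import ring lra.
Set Implicit Arguments. Unset Strict Implicit. Unset Printing Implicit Defensive.
Import Order.TTheory GRing.Theory Num.Theory.
Local Open Scope ring_scope.

(* Put d = x' - x, let B(d) be the matrix with columns A_j d, J(x) the one with
   columns A_j x + a_j (half the Jacobian), and M(l) = I - sum_j l_j A_j.
   Solve B(d) l = d, that is M(l) d = 0, and take u = x - J(x) l.  Since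
   f_j(x) = f_j(x') = 0 one has d^T (A_j x + a_j) = - (d^T A_j d) / 2, whence
   u = x' - J(x') l, u lies on the bisector, and the normal of the hypersurface
   det M = 0 at l, which is (d^T A_j d)_j, is carried to d by both x - J(x) l
   and x' - J(x') l.

   That l lies on the algebraic boundary of the spectrahedron, with the expected
   tangent space, follows from the rational parametrization d |-> B(d)^-1 d of
   det M = 0: a polynomial vanishing on the boundary vanishes on the image of a
   small open set of d's, namely around an eigenvector of A_0 spanning the kernel
   of a boundary point of the form t e_0, hence on the image of all d's, and it
   can be differentiated along the parametrization.

   The generic conditions (J(x), B(d) invertible, corank 1) concern all pairs of
   solutions at once.  The incidence variety of data and pairs is parametrized by
   as many parameters as there are data, and N + 1 polynomials in N variables are
   algebraically dependent: so for a nonzero polynomial h in the parameters there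
   is a nonzero polynomial P in the data whose pullback is a multiple of h. *)

(** * Elimination *)

Section AlgebraicDependence.
Variables (R : fieldType) (N : nat).
Implicit Types p : {mpoly R[N]}.

Lemma msize_expr_le p e k : (msize p <= e.+1)%N -> (msize (p ^+ k) <= (k * e).+1)%N.
Proof.
move=> pe; elim: k => [|k IH]; first by rewrite expr0 msize1.
rewrite exprS; have [->|p0] := eqVneq p 0; first by rewrite mul0r msize0.
have [->|pk0] := eqVneq (p ^+ k) 0; first by rewrite mulr0 msize0.
rewrite msizeM // mulSn -subn1 leq_subLR.
by apply: leq_trans (leq_add pe IH) _; rewrite addnS addSn.
Qed.

Lemma msize_prod_le (I : finType) (F : I -> {mpoly R[N]}) e :
  (forall i, msize (F i) <= e.+1)%N -> (msize (\prod_i F i) <= (#|I| * e).+1)%N.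
Proof.
move=> Fe; rewrite cardE -big_enum /=.
elim: (enum I) => [|i s IH]; first by rewrite big_nil msize1.
rewrite big_cons; have [->|p0] := eqVneq (F i) 0; first by rewrite mul0r msize0.
have [->|pk0] := eqVneq (\prod_(j <- s) F j) 0; first by rewrite mulr0 msize0.
rewrite msizeM // mulSn -subn1 leq_subLR.
by apply: leq_trans (leq_add (Fe i) IH) _; rewrite addnS addSn.
Qed.

(** If [msize] is at most [k], only monomials with all exponents below [k] occur. There are [k ^ N]
    of these, so the coefficient matrix has more rows than columns and a nonzero left kernel. *)
Lemma finite_family_dependent (T : finType) (G : T -> {mpoly R[N]}) k :
  (forall t, msize (G t) <= k)%N -> (k ^ N < #|T|)%N ->
  exists2 c : T -> R, (exists t, c t != 0) & \sum_t c t *: G t = 0.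
Proof.
move=> Gk lt_kT.
pose U := {ffun 'I_N -> 'I_k}.
pose Mx := \matrix_(i < #|T|, j < #|{: U}|)
  (G (enum_val i))@_[multinom (nat_of_ord (enum_val j l)) | l < N].
have rkM : (\rank Mx < #|T|)%N.
  by apply: leq_ltn_trans (rank_leq_col _) _; rewrite card_ffun !card_ord.
have : kermx Mx != 0.
  rewrite kermx_eq0 /row_free neq_ltn rkM //.
case/rowV0Pn => c /sub_kermxP cM c0.
exists (fun t => c ord0 (enum_rank t)).
  have [i ci] : exists i, c ord0 i != 0.
    apply/existsP; apply: contraNT c0 => /existsPn c0; apply/eqP/rowP=> i.
    by rewrite mxE; apply/eqP; rewrite -[_ == _]negbK c0.
  by exists (enum_val i); rewrite enum_valK.
apply/mpolyP=> m; rewrite mcoeff0 raddf_sum /=.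
under eq_bigr do rewrite mcoeffZ.
have [mk|] := boolP [forall l, m l < k]%N; last first.
  case/forallPn=> l; rewrite -leqNgt => kml.
  apply: big1 => t _; rewrite memN_msupp_eq0 ?mulr0 //.
  apply: msize_mdeg_ge; apply: leq_trans (Gk t) (leq_trans kml _).
  by rewrite mdegE (bigD1 l) //= leq_addr.
move/forallP in mk.
pose u : U := [ffun l => Ordinal (mk l)].
have := congr1 (fun X : 'rV_ _ => X ord0 (enum_rank u)) cM.
rewrite !mxE => E0; rewrite -[RHS]E0 [RHS](reindex (@enum_rank T)) /=; last first.
  by exists enum_val => i _; rewrite ?enum_valK ?enum_rankK.
apply: eq_bigr => t _; rewrite mxE !enum_rankK; congr (_ * _@__).
by apply/mnmP=> l; rewrite mnmE /u ffunE.
Qed.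

(** Products of powers of [h] and of the entries of [F] outnumber the monomials available to them,
    so they satisfy a linear relation. Its terms of lowest degree [i0] in [h] add up to
    [h ^+ i0 * (P \mPo F)], and all others contain a further factor [h]. *)
Lemma mpoly_elimination (F : N.-tuple {mpoly R[N]}) (h : {mpoly R[N]}) :
  h != 0 -> exists2 P : {mpoly R[N]}, P != 0 & exists r, P \mPo F = h * r.
Proof.
move=> h0.
pose e := \max_(i < N.+1) msize (if unlift ord_max i is Some j then tnth F j else h).
have Fe j : (msize (tnth F j) <= e.+1)%N.
  have := leq_bigmax (F := fun i =>
    msize (if unlift ord_max i is Some j then tnth F j else h)) (lift ord_max j).
  by rewrite liftK => /leq_trans -> //; rewrite leqnSn.
have he : (msize h <= e.+1)%N.
  have := leq_bigmax (F := fun i =>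
    msize (if unlift ord_max i is Some j then tnth F j else h)) ord_max.
  by rewrite unlift_none => /leq_trans -> //; rewrite leqnSn.
(* With exponents below [k] the products have [msize] at most [k * b], hence at most [(k * b) ^ N]
   monomials, against [k ^ N.+1] products; [k > b ^ N] makes the latter larger. *)
pose b := (N.+1 * e + 1)%N.
pose k := (b ^ N).+1.
pose T := ({ffun 'I_N -> 'I_k} * 'I_k)%type.
pose X (t : T) := \prod_(i < N) tnth F i ^+ t.1 i.
pose G (t : T) := X t * h ^+ t.2.
have ke (i : 'I_k) : (i * e <= k.-1 * e)%N by rewrite leq_mul2r -ltnS ltn_ord orbT.
have Gs t : (msize (G t) <= k * b)%N.
  have h1 : (msize (X t) <= (N * (k.-1 * e)).+1)%N.
    have := @msize_prod_le 'I_N (fun i => tnth F i ^+ t.1 i) (k.-1 * e).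
    rewrite card_ord; apply=> i.
    by apply: leq_trans (msize_expr_le _ (Fe _)) _; rewrite ltnS.
  have h2 : (msize (h ^+ t.2) <= (k.-1 * e).+1)%N.
    by apply: leq_trans (msize_expr_le _ he) _; rewrite ltnS.
  have kb : ((N * (k.-1 * e)).+1 + (k.-1 * e).+1).-1%N = (k.-1 * (N.+1 * e) + 1)%N.
    by rewrite [in RHS]mulSn mulnDr [(k.-1 * (N * e))%N]mulnCA addSn addnS /= addn1 addnC.
  have kb2 : (k.-1 * (N.+1 * e) + 1 <= k * b)%N.
    by rewrite /b mulnDr muln1; apply: leq_add; rewrite ?leq_mul2r ?leq_pred ?orbT.
  have [X0|X0] := eqVneq (X t) 0; first by rewrite /G X0 mul0r msize0.
  rewrite /G msizeM ?expf_neq0 //; apply: leq_trans kb2; rewrite -kb -subn1 leq_subLR add1n.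
  exact: leq_trans (leq_add h1 h2) (leqSpred _).
have cT : ((k * b) ^ N < #|{: T}|)%N.
  rewrite card_prod card_ffun !card_ord expnMn ltn_pmul2l ?expn_gt0 //.
have [c [t0 ct0] sc] := finite_family_dependent Gs cT.
have exi : exists i, [exists m, c (m, i) != 0].
  by case: t0 ct0 => m i ?; exists i; apply/existsP; exists m.
pose i0 := [arg min_(i < xchoose exi | [exists m, c (m, i) != 0]) (i : nat)].
have [m0 cm0 i0min] : exists2 m0, c (m0, i0) != 0 &
    forall m i, c (m, i) != 0 -> (i0 <= i)%N.
  rewrite /i0; case: arg_minnP; first exact: (xchooseP exi).
  move=> i /existsP[m cm] imin; exists m => // m' i' cm'.
  by apply: imin; apply/existsP; exists m'.
pose mon (m : {ffun 'I_N -> 'I_k}) := [multinom (nat_of_ord (m l)) | l < N].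
have mon_inj : injective mon.
  move=> m m' /mnmP eq_m; apply/ffunP=> l; apply: val_inj => /=.
  by have := eq_m l; rewrite !mnmE.
pose P := \sum_m c (m, i0) *: 'X_[mon m] : {mpoly R[N]}.
exists P.
  apply: contraNneq cm0 => /(congr1 (mcoeff (mon m0))) /eqP.
  rewrite mcoeff0 raddf_sum /= (bigD1 m0) //= mcoeffZ mcoeffX eqxx mulr1 big1 ?addr0 //.
  by move=> m /negPf neq; rewrite mcoeffZ mcoeffX (inj_eq mon_inj) neq mulr0.
(* For [i < i0] the truncated exponent is meaningless, but the coefficient is then zero by
   minimality of [i0]. *)
pose r := \sum_m \sum_(i : 'I_k | i != i0) c (m, i) *: (X (m, i) * h ^+ (i - i0).-1).
have PF : P \mPo F = \sum_m c (m, i0) *: X (m, i0).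
  rewrite raddf_sum /=; apply: eq_bigr => m _.
  rewrite comp_mpolyZ comp_mpolyX; congr (_ *: _); apply: eq_bigr => i _.
  by rewrite mnmE.
exists (- r).
have : h ^+ i0 * (P \mPo F + h * r) = 0.
  rewrite -sc PF /r /G.
  rewrite (eq_bigr (fun t : T => c (t.1, t.2) *: (X (t.1, t.2) * h ^+ t.2))); last by case.
  rewrite -(pair_bigA _ (fun m i => c (m, i) *: (X (m, i) * h ^+ (i : nat)))) /=.
  rewrite mulr_sumr -big_split mulr_sumr; apply: eq_bigr => m _ /=.
  rewrite [RHS](bigD1 i0) //= mulrDr; congr (_ + _).
    by rewrite -scalerAr mulrC.
  rewrite !mulr_sumr; apply: eq_bigr => i ii0.
  have [->|ci] := eqVneq (c (m, i)) 0; first by rewrite !scale0r !mulr0.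
  rewrite -!scalerAr; congr (_ *: _).
  have := i0min _ _ ci; rewrite leq_eqVlt => /orP[/eqP/val_inj ie|lti].
    by rewrite ie eqxx in ii0.
  rewrite [h * (X _ * _)]mulrCA [LHS]mulrCA -exprS -exprD; congr (_ * _ ^+ _).
  by rewrite prednK ?subn_gt0 // subnKC // ltnW.
by move/eqP; rewrite mulf_eq0 expf_eq0 (negPf h0) andbF /= addr_eq0 -mulrN => /eqP.
Qed.

End AlgebraicDependence.

(** * Polynomial dependence of scalars and matrices on parameters *)

Section PolynomialFunctions.
Variables (R S : comNzRingType) (V : Type) (ev : V -> {rmorphism S -> R}).

(** The ring [S] and its evaluations stay abstract so that the same closure lemmas serve for
    families of coefficients, for one real variable and for points of the space. *)
Definition polyof (f : V -> R) := exists p : S, forall v, f v = ev v p.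

Lemma polyof_ext f g : f =1 g -> polyof f -> polyof g.
Proof. by move=> fg [p fp]; exists p => v; rewrite -fg. Qed.

Lemma polyofD f g : polyof f -> polyof g -> polyof (fun v => f v + g v).
Proof. by move=> [p fp] [q gq]; exists (p + q) => v; rewrite rmorphD fp gq. Qed.

Lemma polyofN f : polyof f -> polyof (fun v => - f v).
Proof. by move=> [p fp]; exists (- p) => v; rewrite rmorphN fp. Qed.

Lemma polyofM f g : polyof f -> polyof g -> polyof (fun v => f v * g v).
Proof. by move=> [p fp] [q gq]; exists (p * q) => v; rewrite rmorphM fp gq. Qed.

Lemma polyof0 : polyof (fun=> 0).
Proof. by exists 0 => v; rewrite rmorph0. Qed.

Lemma polyof1 : polyof (fun=> 1).
Proof. by exists 1 => v; rewrite rmorph1. Qed.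

Lemma polyof_sum (I : Type) (r : seq I) (P : pred I) (F : V -> I -> R) :
  (forall i, polyof (F^~ i)) -> polyof (fun v => \sum_(i <- r | P i) F v i).
Proof.
move=> hF; elim: r => [|i r IH].
  by apply: polyof_ext polyof0 => v; rewrite big_nil.
apply: polyof_ext (fun v => if P i then F v i + \sum_(j <- r | P j) F v j
  else \sum_(j <- r | P j) F v j) _ _ _ => [v|]; first by rewrite big_cons.
by case: (P i) => //; apply: polyofD.
Qed.

Lemma polyof_prod (I : Type) (r : seq I) (P : pred I) (F : V -> I -> R) :
  (forall i, polyof (F^~ i)) -> polyof (fun v => \prod_(i <- r | P i) F v i).
Proof.
move=> hF; elim: r => [|i r IH].
  by apply: polyof_ext polyof1 => v; rewrite big_nil.
apply: polyof_ext (fun v => if P i then F v i * \prod_(j <- r | P j) F v j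
  else \prod_(j <- r | P j) F v j) _ _ _ => [v|]; first by rewrite big_cons.
by case: (P i) => //; apply: polyofM.
Qed.

Lemma polyof_sign (k : nat) : polyof (fun=> (-1) ^+ k).
Proof. by exists ((-1) ^+ k) => v; rewrite rmorphXn rmorphN1. Qed.

Definition polymx m n (M : V -> 'M[R]_(m, n)) := forall i j, polyof (fun v => M v i j).

Lemma polymx_matrix m n (E : V -> 'I_m -> 'I_n -> R) :
  (forall i j, polyof (fun v => E v i j)) -> polymx (fun v => \matrix_(i, j) E v i j).
Proof. by move=> hE i j; apply: polyof_ext (hE i j) => v; rewrite mxE. Qed.

Lemma polymxM m n p (M : V -> 'M[R]_(m, n)) (N : V -> 'M[R]_(n, p)) :
  polymx M -> polymx N -> polymx (fun v => M v *m N v).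
Proof.
move=> hM hN i j.
apply: polyof_ext (fun v => \sum_k M v i k * N v k j) _ _ _ => [v|].
  by rewrite mxE.
by apply: polyof_sum => k; apply: polyofM.
Qed.

Lemma polymxD m n (M N : V -> 'M[R]_(m, n)) :
  polymx M -> polymx N -> polymx (fun v => M v + N v).
Proof.
move=> hM hN i j; apply: polyof_ext (fun v => M v i j + N v i j) _ _ _ => [v|].
  by rewrite mxE.
exact: polyofD.
Qed.

Lemma polymxN m n (M : V -> 'M[R]_(m, n)) : polymx M -> polymx (fun v => - M v).
Proof.
move=> hM i j; apply: polyof_ext (fun v => - M v i j) _ _ _ => [v|].
  by rewrite mxE.
exact: polyofN.
Qed.

Lemma polymxZ m n (f : V -> R) (M : V -> 'M[R]_(m, n)) :
  polyof f -> polymx M -> polymx (fun v => f v *: M v).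
Proof.
move=> hf hM i j; apply: polyof_ext (fun v => f v * M v i j) _ _ _ => [v|].
  by rewrite mxE.
exact: polyofM.
Qed.

Lemma polymxT m n (M : V -> 'M[R]_(m, n)) : polymx M -> polymx (fun v => (M v)^T).
Proof. by move=> hM i j; apply: polyof_ext (hM j i) => v; rewrite mxE. Qed.

Lemma polymx_scalar n (f : V -> R) : polyof f -> polymx (fun v => (f v)%:M : 'M_n).
Proof.
move=> hf i j; have [<-|/negPf ij] := eqVneq i j.
  by apply: polyof_ext hf => v; rewrite mxE eqxx.
by apply: polyof_ext polyof0 => v; rewrite mxE ij.
Qed.

Lemma polymx_sum m n (I : finType) (M : V -> I -> 'M[R]_(m, n)) :
  (forall k, polymx (M^~ k)) -> polymx (fun v => \sum_k M v k).
Proof.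
move=> hM i j; apply: polyof_ext (fun v => \sum_k M v k i j) _ _ _ => [v|].
  by rewrite summxE.
by apply: polyof_sum => k; apply: hM.
Qed.

Lemma polyof_det n (M : V -> 'M[R]_n) : polymx M -> polyof (fun v => \det (M v)).
Proof.
move=> hM; apply: polyof_sum => s; apply: polyofM; first exact: polyof_sign.
by apply: polyof_prod => i; apply: hM.
Qed.

Lemma polymx_adj n (M : V -> 'M[R]_n) : polymx M -> polymx (fun v => \adj (M v)).
Proof.
move=> hM i j; apply: polyof_ext (fun v => cofactor (M v) j i) _ _ _ => [v|].
  by rewrite mxE.
apply: polyofM; first exact: polyof_sign.
by apply: polyof_det => k l; apply: polyof_ext (hM _ _) => v; rewrite !mxE.
Qed.

End PolynomialFunctions.

(** * Nonvanishing of real polynomials, and elimination for polynomial functions *)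

Section NonVanishing.
Variable R : realType.

Lemma poly_eq0_itv (p : {poly R}) (a b : R) :
  a < b -> (forall t, a < t -> t < b -> p.[t] = 0) -> p = 0.
Proof.
move=> ab hp; apply/eqP; apply: contraT => p0.
(* Distinct points strictly inside the interval; denominators start at 2 to avoid the endpoint
   [b]. *)
pose g (i : nat) := a + (b - a) / (i.+2)%:R.
have gi : injective g.
  move=> i j /addrI /(mulfI _); rewrite subr_eq0 gt_eqF // => /(_ isT).
  by move/invr_inj/eqP; rewrite eqr_nat => /eqP[].
have := max_poly_roots (rs := [seq g i | i <- iota 0 (size p)]) p0.
rewrite size_map size_iota ltnn map_inj_uniq ?iota_uniq // => -> //.
apply/allP => _ /mapP[i _ ->]; apply/rootP/hp.
  by rewrite ltrDl divr_gt0 ?subr_gt0 ?ltr0n.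
by rewrite -ltrBrDl ltr_pdivrMr ?ltr0n // ltr_pMr ?subr_gt0 // ltr1n.
Qed.

(** Digits in base [k] are recovered by reduction modulo [k]; this separates the exponents in the
    Kronecker substitution below. *)
Lemma digits_inj (k n : nat) (f g : 'I_n -> nat) :
  (forall i, f i < k)%N -> (forall i, g i < k)%N ->
  (\sum_(i < n) f i * k ^ i = \sum_(i < n) g i * k ^ i)%N -> f =1 g.
Proof.
elim: n f g => [|n IH] f g fk gk; first by move=> _ [].
have split_k h : (\sum_(i < n.+1) h i * k ^ i = h ord0 + k * \sum_(i < n) h (lift ord0 i) * k ^ i)%N.
  rewrite big_ord_recl /= expn0 muln1 big_distrr /=; congr addn.
  by apply: eq_bigr => i _; rewrite expnS mulnCA.
rewrite !split_k => E.
have k0 : (0 < k)%N by apply: leq_ltn_trans (fk ord0).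
have E0 : f ord0 = g ord0.
  have := congr1 (modn^~ k) E.
  by rewrite ![(k * _)%N]mulnC ![(_ + _ * k)%N]addnC !modnMDl !modn_small.
move: E; rewrite E0 => /addnI /eqP; rewrite eqn_pmul2l // => /eqP E1.
have {}IH := IH _ _ (fun i => fk _) (fun i => gk _) E1.
by move=> i; case: (unliftP ord0 i) => [j|] ->.
Qed.

(* Kronecker substitution ['X_i := t ^ (k ^ i)] sends distinct monomials with
   exponents below [k] to distinct powers of [t]. *)
Lemma mpoly_neq0_eval n (p : {mpoly R[n]}) : p != 0 -> exists v, p.@[v] != 0.
Proof.
move=> p0.
pose k := msize p.
have mk m (i : 'I_n) : m \in msupp p -> (m i < k)%N.
  move/msize_mdeg_lt; apply: leq_ltn_trans.
  by rewrite mdegE (bigD1 i) //= leq_addr.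
pose w (m : 'X_{1..n}) := (\sum_(i < n) m i * k ^ i)%N.
pose q : {poly R} := \sum_(m <- msupp p) p@_m *: 'X^(w m).
have qE t : q.[t] = p.@[fun i => t ^+ (k ^ i)].
  rewrite mevalE horner_sum; apply: eq_bigr => m _.
  rewrite hornerZ hornerXn; congr (_ * _).
  rewrite (eq_bigr (fun i : 'I_n => t ^+ (m i * k ^ i))).
    by rewrite prodrXr.
  by move=> i _; rewrite -exprM mulnC.
have q0 : q != 0.
  apply/negP => /eqP /(congr1 (fun r : {poly R} => r`_(w (mlead p)))).
  rewrite coef0 coef_sum (bigD1_seq (mlead p)) ?msupp_uniq ?mlead_supp //=.
  rewrite coefZ coefXn eqxx mulr1 big1_seq ?addr0; last first.
    move=> m /andP[neq mp]; rewrite coefZ coefXn; case: eqP; rewrite ?mulr0 //.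
    move/esym/digits_inj => E; case/eqP: neq; apply/mnmP.
    by apply: E => i; apply: mk => //; apply: mlead_supp.
  by move=> E; have := mlead_supp p0; rewrite mcoeff_msupp E eqxx.
case: (pselect (exists v, p.@[v] != 0)) => // nv.
case/eqP: q0; apply: (@poly_eq0_itv _ 0 1) => // t _ _; rewrite qE.
by apply/eqP; apply: contra_notT nv => ?; eexists; eassumption.
Qed.

Variable K : finType.

Definition mev (v : K -> R) : {rmorphism {mpoly R[#|K|]} -> R} :=
  meval (fun i => v (enum_val i)).

Definition polyfun := polyof mev.

Lemma polyfun_cst c : polyfun (fun=> c).
Proof. by exists c%:MP => v; rewrite /= mevalC. Qed.

Lemma polyfun_coord k : polyfun (fun v => v k).
Proof. by exists 'X_(enum_rank k) => v; rewrite /= mevalXU enum_rankK. Qed.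

(** The polynomial ring is a domain and its nonzero elements have nonzero values, so two generic
    conditions can be met together. *)
Lemma polyfunM_neq0 f g : polyfun f -> polyfun g ->
  (exists v, f v != 0) -> (exists v, g v != 0) -> exists v, f v * g v != 0.
Proof.
move=> [p fp] [q gq] [v fv] [w gw].
have p0 : p != 0 by apply: contraNneq fv => p0; rewrite fp p0 rmorph0.
have q0 : q != 0 by apply: contraNneq gw => q0; rewrite gq q0 rmorph0.
have [u] := mpoly_neq0_eval (mulf_neq0 p0 q0).
rewrite mevalM => uu; exists (fun k => u (enum_rank k)); rewrite fp gq /=.
by congr (_ * _ != 0): uu; apply: meval_eq => i; rewrite enum_valK.
Qed.

Lemma polyfun_prod_neq0 (I : finType) (f : I -> (K -> R) -> R) :
  (forall i, polyfun (f i)) -> (forall i, exists v, f i v != 0) ->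
  exists v, \prod_i f i v != 0.
Proof.
move=> fp f0.
suff [_ [v hv]] : polyfun (fun v => \prod_(i <- enum I) f i v) /\
  exists v, \prod_(i <- enum I) f i v != 0 by exists v; rewrite -big_enum.
elim: (enum I) => [|i s [IHp IH]].
  split; first by apply: polyof_prod => i; apply: fp.
  by exists (fun=> 0); rewrite big_nil oner_neq0.
split; first by apply: polyof_prod => j; apply: fp.
have [v] := polyfunM_neq0 (fp i) IHp (f0 i) IH.
by exists v; rewrite big_cons.
Qed.

Lemma polyfun_comp (f : (K -> R) -> R) (F : (K -> R) -> K -> R) :
  polyfun f -> (forall k, polyfun (fun v => F v k)) -> polyfun (fun v => f (F v)).
Proof.
move=> [p fp] hF; have /fin_all_exists[q hq] k := hF k.
exists (p \mPo [tuple q (enum_val i) | i < #|K|]) => v.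
rewrite fp /= comp_mpoly_meval; apply: meval_eq => i.
by rewrite tnth_mktuple hq.
Qed.

(** Meant for a chart [F] from parameters to data and a condition [h] on the parameters. Since [P]
    composed with [F] is a multiple of [h], one condition on the data controls all its preimages at
    once. *)
Lemma polyfun_elimination (F : (K -> R) -> K -> R) (h : (K -> R) -> R) :
  (forall k, polyfun (fun v => F v k)) -> polyfun h -> (exists v, h v != 0) ->
  exists P, [/\ polyfun P, exists v, P v != 0 & forall v, P (F v) != 0 -> h v != 0].
Proof.
move=> hF [p hp] [v0 hv0]; have /fin_all_exists[q hq] k := hF k.
have p0 : p != 0 by apply: contraNneq hv0 => p0; rewrite hp p0 rmorph0.
have [P P0 [r Pr]] := mpoly_elimination [tuple q (enum_val i) | i < #|K|] p0.
exists (fun v => P.@[fun i => v (enum_val i)]); split.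
- by exists P.
- have [u Pu] := mpoly_neq0_eval P0; exists (fun k => u (enum_rank k)).
  by congr (_ != 0): Pu; apply: meval_eq => i; rewrite enum_valK.
- move=> v; apply: contraNneq => hv.
  have := congr1 (mev v) Pr; rewrite rmorphM -hp hv mul0r /= comp_mpoly_meval => E.
  by apply/eqP; rewrite -[RHS]E; apply/meval_eq => i; rewrite tnth_mktuple hq.
Qed.

End NonVanishing.

(** * Genericity *)

Section GenericConditions.
Variables (R : realType) (n : nat).
Implicit Types (A : 'I_n -> 'M[R]_n) (a : 'I_n -> 'cV[R]_n) (d x : 'cV[R]_n).

Definition Bmx A d : 'M[R]_n := \matrix_(i, j) (A j *m d) i ord0.
Definition Jmx A a x : 'M[R]_n := \matrix_(i, j) (A j *m x + a j) i ord0.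
Definition lcomb A (lam : 'cV[R]_n) : 'M[R]_n := \sum_j lam j ord0 *: A j.

(* For a symmetric matrix [M] with [M *m d = 0] and [d != 0], invertibility of
   [M + d *m d^T] says that the kernel of [M] is exactly the line spanned by [d].
   Here [M] is [\det (Bmx A d)] times [1 - lcomb A lam], [lam] being the solution
   of [Bmx A d *m lam = d]. *)
Definition corank1_mx A d : 'M[R]_n :=
  (\det (Bmx A d))%:M - lcomb A (\adj (Bmx A d) *m d) + d *m d^T.

(* Symmetric matrices read off the upper triangular coefficients; the lower
   ones are dummies, so that all coefficients are independent parameters. *)
Definition symU (v : coefT n -> R) (j : 'I_n) : 'M[R]_n :=
  \matrix_(k, m) v (inl (inl (if (k <= m)%N then (j, k, m) else (j, m, k)))).
Definition acol (v : coefT n -> R) (j : 'I_n) : 'cV[R]_n := \col_i v (inl (inr (j, i))).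

Lemma symU_tr v j : (symU v j)^T = symU v j.
Proof. by apply/matrixP=> k m; rewrite !mxE; case: ltngtP => // /val_inj ->. Qed.

Lemma symUE v j (M : 'M[R]_n) : M^T = M ->
  (forall k m : 'I_n, (k <= m)%N -> v (inl (inl (j, k, m))) = M k m) -> symU v j = M.
Proof.
move=> Ms hv; apply/matrixP=> k m; rewrite mxE; case: leqP => km; first exact: hv.
by rewrite hv 1?ltnW // -[in RHS]Ms mxE.
Qed.

Section PolyMatrices.
Variables (S : comNzRingType) (V : Type) (ev : V -> {rmorphism S -> R}).
Variables (A : V -> 'I_n -> 'M[R]_n) (d : V -> 'cV[R]_n).
Hypotheses (hA : forall j, polymx ev (A^~ j)) (hd : polymx ev d).

Lemma polymx_Bmx : polymx ev (fun v => Bmx (A v) (d v)).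
Proof. by apply: polymx_matrix => i j; apply: polymxM. Qed.

Lemma polymx_lcomb : polymx ev (fun v => lcomb (A v) (d v)).
Proof. by apply: polymx_sum => j; apply: polymxZ. Qed.

End PolyMatrices.

Lemma polymx_corank1 (S : comNzRingType) (V : Type) (ev : V -> {rmorphism S -> R})
    (A : V -> 'I_n -> 'M[R]_n) (d : V -> 'cV[R]_n) :
  (forall j, polymx ev (A^~ j)) -> polymx ev d ->
  polymx ev (fun v => corank1_mx (A v) (d v)).
Proof.
move=> hA hd; have hB := polymx_Bmx hA hd.
apply: polymxD; last by apply: polymxM => //; apply: polymxT.
apply: polymxD; first by apply: polymx_scalar; apply: polyof_det.
apply: polymxN; apply: polymx_lcomb => //; apply: polymxM => //.
exact: polymx_adj.
Qed.

Lemma polymx_symU j : polymx (@mev R (coefT n)) (symU^~ j).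
Proof. by apply: polymx_matrix => k m; apply: polyfun_coord. Qed.

(** * Data with a pair of solutions whose difference has a nonzero coordinate [l] *)

Section PairChart.
Variable l : 'I_n.

(** The slot [inr j] holds a coordinate of [x], and [inl (inr (k, l))] holds [d_k / d_l], or [d_l]
    itself when [k = l]. The data coefficients normally in these slots are determined by the pair,
    so parameters and data are equally many. *)
Let px (v : coefT n -> R) : 'cV[R]_n := \col_j v (inr j).
Let pe (v : coefT n -> R) : 'cV[R]_n := \col_k if k == l then 1 else v (inl (inr (k, l))).
Let pd (v : coefT n -> R) : 'cV[R]_n := v (inl (inr (l, l))) *: pe v.
(** Subtracting [f_j(x) = 0] from [f_j(x + d) = 0] and dividing by [2 d_l] gives an equation solved
    here for coordinate [l] of [a_j]. The constant term is then solved from [f_j(x) = 0] in [pF]. *)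
Let pa (v : coefT n -> R) (j : 'I_n) : 'cV[R]_n :=
  \col_i if i == l then
    - (2^-1 * v (inl (inr (l, l))) * ((pe v)^T *m symU v j *m pe v) ord0 ord0)
    - ((pe v)^T *m symU v j *m px v) ord0 ord0
    - \sum_(k | k != l) v (inl (inr (j, k))) * pe v k ord0
  else v (inl (inr (j, i))).
Let pF (v : coefT n -> R) (c : coefT n) : R :=
  match c with
  | inl (inl _) => v c
  | inl (inr (j, i)) => pa v j i ord0
  | inr j => - (((px v)^T *m symU v j *m px v) ord0 ord0
              + 2 * ((pa v j)^T *m px v) ord0 ord0)
  end.
Let ph v := \det (Jmx (symU v) (pa v) (px v)) * \det (Bmx (symU v) (pd v)) *
  \det (corank1_mx (symU v) (pd v)).

Let px_poly : polymx (@mev R (coefT n)) px.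
Proof. by apply: polymx_matrix => i j; apply: polyfun_coord. Qed.

Let pe_poly : polymx (@mev R (coefT n)) pe.
Proof.
apply: polymx_matrix => i j; case: (i == l); first exact: polyfun_cst.
exact: polyfun_coord.
Qed.

Let pd_poly : polymx (@mev R (coefT n)) pd.
Proof. by apply: polymxZ => //; apply: polyfun_coord. Qed.

Let pa_poly j : polymx (@mev R (coefT n)) (pa^~ j).
Proof.
apply: polymx_matrix => i j'; case: (i == l); last exact: polyfun_coord.
have hS := @polymx_symU j.
apply: polyofD; first apply: polyofD.
- apply: polyofN; apply: polyofM; last by do 2?apply: polymxM => //; apply: polymxT.
  by apply: polyofM; [apply: polyfun_cst | apply: polyfun_coord].
- by apply: polyofN; do 2?apply: polymxM => //; apply: polymxT.
- apply: polyofN; apply: polyof_sum => k; apply: polyofM => //.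
  exact: polyfun_coord.
Qed.

Let pF_poly c : polyfun (fun v => pF v c).
Proof.
case: c => [[c|[j i]]|j]; [exact: polyfun_coord|exact: pa_poly|].
have hS := @polymx_symU j.
apply: polyofN; apply: polyofD; first by do 2?apply: polymxM => //; apply: polymxT.
by apply: polyofM; [apply: polyfun_cst|apply: polymxM => //; apply: polymxT].
Qed.

Let ph_poly : polyfun ph.
Proof.
have hS := @polymx_symU; apply: polyofM; first apply: polyofM; apply: polyof_det.
- apply: polymx_matrix => i j; apply: polymxD => //; exact: polymxM.
- exact: polymx_Bmx.
- exact: polymx_corank1.
Qed.

(** A sample point with [x = 0], [d = e_l] and symmetric [A_j] such that [A_j e_l = e_j]: there
    [Bmx] and [corank1_mx] are the identity, and [Jmx] is diagonal with entry [-1/2] at [l] and [1]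
    elsewhere. *)
Let w (c : coefT n) : R :=
  match c with
  | inl (inl (j, k, m)) => (((k == j) && (m == l)) || ((k == l) && (m == j)))%:R
  | inl (inr (k, i)) => if i == l then (k == l)%:R else (k == i)%:R
  | inr _ => 0
  end.

Let ph_w : ph w != 0.
Proof.
have eE : pe w = delta_mx l ord0.
  by apply/colP=> k; rewrite !mxE /= !eqxx andbT; case: (k == l).
have dE : pd w = delta_mx l ord0 by rewrite /pd eE /= !eqxx scale1r.
have xE : px w = 0 by apply/colP=> k; rewrite !mxE.
have SE j : symU w j = \matrix_(k, m) (((k == j) && (m == l)) || ((k == l) && (m == j)))%:R.
  apply: symUE => [|k m _]; last by rewrite mxE.
  by apply/matrixP=> k m; rewrite !mxE orbC [X in (X || _)]andbC [X in (_ || X)]andbC.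
have Sl j : symU w j *m delta_mx l ord0 = delta_mx j ord0 :> 'cV[R]_n.
  have -> : symU w j *m delta_mx l ord0 = col l (symU w j) by rewrite colE.
  rewrite SE; apply/colP=> k; rewrite !mxE !eqxx !andbT.
  have [->|kj] := eqVneq k j; rewrite ?eqxx //=.
  by have [<-|//] := eqVneq k l; rewrite (negPf kj).
have BE : Bmx (symU w) (delta_mx l ord0) = 1%:M.
  by apply/matrixP=> i j; rewrite mxE Sl !mxE !eqxx andbT.
have Sll : symU w l = delta_mx l l.
  by rewrite SE; apply/matrixP=> k m; rewrite !mxE orbb.
have CE : corank1_mx (symU w) (delta_mx l ord0) = 1%:M.
  rewrite /corank1_mx BE adj1 det1 mul1mx trmx_delta mul_delta_mx /lcomb.
  rewrite (bigD1 l) //= mxE !eqxx scale1r Sll big1 ?addr0 ?subrK // => j jl.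
  by rewrite mxE (negPf jl) scale0r.
have JE : Jmx (symU w) (pa w) (px w) = diag_mx (\row_i if i == l then - 2^-1 else 1).
  apply/matrixP=> i j; rewrite [LHS]mxE xE mulmx0 add0r [LHS]mxE xE eE [RHS]mxE [in RHS]mxE.
  case: (eqVneq i l) => [->|il] /=.
    have -> : ((delta_mx l ord0 : 'cV[R]_n)^T *m symU w j *m (delta_mx l ord0 : 'cV_n)) ord0 ord0 = (l == j)%:R.
      by rewrite -mulmxA Sl trmx_delta mul_delta_mx_cond; case: (l == j); rewrite !mxE.
    rewrite mulmx0 [X in _ - X - _]mxE subr0 big1 ?subr0; last first.
      by move=> k kl; rewrite mxE (negPf kl) mulr0.
    by rewrite eqxx mulr1; case: (l == j); rewrite ?mulr1 ?mulr0 ?oppr0.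
  by rewrite ?(negPf il) [j == i]eq_sym; case: (i == j).
rewrite /ph dE BE CE JE !det1 !mulr1 det_diag; apply/prodf_neq0 => i _.
rewrite mxE; case: ifP => _; rewrite ?oner_neq0 // oppr_eq0 invr_eq0 pnatr_eq0 //.
Qed.

(** Data together with any such pair come from a point of the chart, so the eliminated polynomial at
    the data forces [ph] to be nonzero at every such pair. *)
Lemma generic_pair_chart : exists P,
  [/\ polyfun P, exists v : coefT n -> R, P v != 0 &
    forall v, P v != 0 -> forall x d, d l ord0 != 0 ->
    (forall j, (x^T *m symU v j *m x) ord0 ord0 + 2 * ((acol v j)^T *m x) ord0 ord0
               + v (inr j) = 0) ->
    (forall j, (d^T *m symU v j *m d) ord0 ord0
               + 2 * (d^T *m (symU v j *m x + acol v j)) ord0 ord0 = 0) ->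
    [/\ \det (Jmx (symU v) (acol v) x) != 0, \det (Bmx (symU v) d) != 0 &
        \det (corank1_mx (symU v) d) != 0]].
Proof.
have [P [hP P0 PF]] := polyfun_elimination pF_poly ph_poly (ex_intro (fun v => ph v != 0) w ph_w).
exists P; split=> // k Pk x d dl H1 H2.
(* The inverse of the chart at [(x, d)]: [H2] gives back the [a_j] and [H1] the constant terms. *)
pose v (c : coefT n) : R := match c with
  | inl (inl _) => k c
  | inl (inr (j, m)) =>
      if m == l then (if j == l then d l ord0 else d j ord0 / d l ord0) else k c
  | inr j => x j ord0
  end.
have xE : px v = x by apply/colP=> j; rewrite mxE.
have sE : v (inl (inr (l, l))) = d l ord0 by rewrite /= eqxx.
have dE : pd v = d.
  apply/colP=> j; rewrite /pd sE !mxE /= eqxx.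
  by case: (eqVneq j l) => [->|jl]; rewrite ?mulr1 // mulrC divfK.
have SE : symU v = symU k by apply/funext=> j; apply/matrixP=> i m; rewrite !mxE.
have aE : pa v = acol k.
  apply/funext=> j; apply/colP=> i; rewrite mxE [RHS]mxE.
  case: (eqVneq i l) => [->|il]; last by rewrite /= (negPf il).
  have mxZ (c : R) (M : 'M[R]_1) : (c *: M) ord0 ord0 = c * M ord0 ord0 by rewrite mxE.
  have mxD (M N : 'M[R]_1) : (M + N) ord0 ord0 = M ord0 ord0 + N ord0 ord0 by rewrite mxE.
  have := H2 j; rewrite -dE /pd sE SE xE; set e := pe v.
  have -> : (d l ord0 *: e)^T = d l ord0 *: e^T by apply/matrixP=> ? ?; rewrite !mxE.
  rewrite -!scalemxAl -scalemxAr !mxZ mulmxDr mxD mulmxA.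
  have -> : (e^T *m acol k j) ord0 ord0 = k (inl (inr (j, l))) +
      \sum_(m | m != l) v (inl (inr (j, m))) * e m ord0.
    rewrite mxE (bigD1 l) //= !mxE eqxx mul1r; congr (_ + _).
    by apply: eq_bigr => m ml; rewrite !mxE (negPf ml) mulrC.
  set q2 := (_ *m _ *m e) ord0 ord0; set q3 := (_ *m _ *m x) ord0 ord0.
  set q4 := \sum_(m | _) _; move=> H; have : d l ord0 * (d l ord0 * q2 + 2 * (q3 + (k (inl (inr (j, l))) + q4))) = 0.
    by rewrite -[RHS]H; ring.
  by move/eqP; rewrite mulf_eq0 (negPf dl) /= => /eqP H'; lra.
have FE : pF v = k.
  apply/funext=> -[[c|[j i]]|j] //=; first by rewrite aE mxE.
  by rewrite aE xE SE; have := H1 j; lra.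
have := PF v; rewrite FE /ph SE aE xE dE => /(_ Pk).
by rewrite !mulf_eq0 !negb_or => /andP[/andP[]].
Qed.

End PairChart.
End GenericConditions.

(** * Data in which one matrix has a marked eigenvector *)

Section GenericEigenvectors.
Variables (R : realType) (n : nat) (o l : 'I_n).

(** In the slots of the matrix of index [o], entry [(l, l)] holds an eigenvalue, and the rest of row
    and column [l] an eigenvector normalized to have coordinate [1] at [l]. Again there are as many
    parameters as data. *)
Let pV (v : coefT n -> R) := symU v o.
Let pt (v : coefT n -> R) : R := pV v l l.
Let pe (v : coefT n -> R) : 'cV[R]_n := \col_k if k == l then 1 else pV v k l.

(* The projection along [e] onto the hyperplane where the coordinate [l]
   vanishes; a symmetric matrix killing [e] is determined by its compression. *)
Let proj (e : 'cV[R]_n) : 'M[R]_n := 1%:M - e *m (delta_mx l ord0)^T.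
Let pA (v : coefT n -> R) : 'M[R]_n :=
  (pt v)%:M + (proj (pe v))^T *m (pV v - (pt v)%:M) *m proj (pe v).
Let pF (v : coefT n -> R) (c : coefT n) : R :=
  match c with
  | inl (inl (j, k, m)) => if (j == o) && (k <= m)%N then pA v k m else v c
  | _ => v c
  end.
Let ph v := \det (Bmx (symU (pF v)) (pe v)) *
  \det ((pt v)%:M - pA v + pe v *m (pe v)^T).

Let pt_poly : polyfun pt.
Proof. exact: polymx_symU. Qed.

Let pe_poly : polymx (@mev R (coefT n)) pe.
Proof.
apply: polymx_matrix => i j; case: (i == l); first exact: polyfun_cst.
exact: polymx_symU.
Qed.

Let pA_poly : polymx (@mev R (coefT n)) pA.
Proof.
have hS := @polymx_symU R n o.
have ht : polymx (@mev R (coefT n)) (fun v => (pt v)%:M : 'M_n) by apply: polymx_scalar.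
have hp : polymx (@mev R (coefT n)) (fun v => proj (pe v)).
  apply: polymxD; first by apply: polymx_scalar; apply: polyfun_cst.
  by apply: polymxN; apply: polymxM => // i j; apply: polyfun_cst.
apply: polymxD => //; apply: polymxM => //; apply: polymxM; first exact: polymxT.
by apply: polymxD => //; apply: polymxN.
Qed.

Let pF_poly c : polyfun (fun v => pF v c).
Proof.
case: c => [[[[j k] m]|c]|c]; try exact: polyfun_coord.
by rewrite /=; case: ((j == o) && (k <= m)%N); [apply: pA_poly|apply: polyfun_coord].
Qed.

Let ph_poly : polyfun ph.
Proof.
apply: polyofM; apply: polyof_det.
  apply: polymx_Bmx => // j; apply: polymx_matrix => k m; exact: pF_poly.
apply: polymxD; last by apply: polymxM => //; apply: polymxT.
by apply: polymxD; [apply: polymx_scalar|apply: polymxN].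
Qed.

Let proj_row (e : 'cV[R]_n) m : e l ord0 = 1 -> proj e l m = 0.
Proof.
move=> el; rewrite !mxE big_ord1 !mxE el mul1r eqxx andbT eq_sym.
by rewrite subrr.
Qed.

Let pA_tr v : (pA v)^T = pA v.
Proof.
rewrite /pA [LHS]linearD /= tr_scalar_mx; congr (_ + _).
have VT : (pV v - (pt v)%:M)^T = pV v - (pt v)%:M.
  by rewrite linearB /= tr_scalar_mx /pV symU_tr.
by rewrite [LHS]trmx_mul trmx_mul trmxK VT mulmxA.
Qed.

Let symU_pF v j : symU (pF v) j = if j == o then pA v else symU v j.
Proof.
case: ifP => jo; apply: symUE; rewrite ?pA_tr ?symU_tr // => k m km.
  by rewrite /= jo km.
by rewrite /= jo /= mxE km.
Qed.

(* The compression ignores row and column [l], so [pA] recovers [M] from the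
   eigenvalue, the eigenvector and the remaining entries. *)
Let pA_recover v (M : 'M[R]_n) : M^T = M -> M *m pe v = pt v *: pe v ->
  (forall k m, k != l -> m != l -> pV v k m = M k m) -> pA v = M.
Proof.
move=> Ms Me VM.
have el : pe v l ord0 = 1 by rewrite mxE eqxx.
have -> : pA v = (pt v)%:M + (proj (pe v))^T *m (M - (pt v)%:M) *m proj (pe v).
  congr (_ + _); apply/matrixP=> i j; rewrite !mxE; apply: eq_bigr => m _.
  have [->|ml] := eqVneq m l; first by rewrite proj_row // !mulr0.
  congr (_ * _); rewrite !mxE; apply: eq_bigr => k _.
  have [->|kl] := eqVneq k l; first by rewrite mxE proj_row // !mul0r.
  by congr (_ * _); rewrite [LHS]mxE [RHS]mxE VM.
have N0 : (M - (pt v)%:M) *m pe v = 0 by rewrite mulmxBl Me mul_scalar_mx subrr.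
have Np : (M - (pt v)%:M) *m proj (pe v) = M - (pt v)%:M.
  by rewrite /proj mulmxBr mulmx1 mulmxA N0 mul0mx subr0.
have pN : (proj (pe v))^T *m (M - (pt v)%:M) = M - (pt v)%:M.
  have NT : (M - (pt v)%:M)^T = M - (pt v)%:M by rewrite linearB /= Ms tr_scalar_mx.
  by have := congr1 trmx Np; rewrite trmx_mul NT.
by rewrite pN Np addrC subrK.
Qed.

(** The matrices of this sample point send [e_l] to the basis vector of index [tperm o l j]. The
    transposition makes [e_l] an eigenvector of [A_o] and [Bmx] a permutation matrix. *)
Let w (c : coefT n) : R :=
  match c with
  | inl (inl (j, k, m)) => (((k == tperm o l j) && (m == l)) || ((k == l) && (m == tperm o l j)))%:R
  | _ => 0
  end.

Let ph_w : ph w != 0.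
Proof.
have SE j : symU w j = \matrix_(k, m)
    (((k == tperm o l j) && (m == l)) || ((k == l) && (m == tperm o l j)))%:R.
  apply: symUE => [|k m _]; last by rewrite mxE.
  by apply/matrixP=> k m; rewrite !mxE orbC [X in (X || _)]andbC [X in (_ || X)]andbC.
have So : symU w o = delta_mx l l.
  by rewrite SE; apply/matrixP=> k m; rewrite !mxE tpermL orbb.
have tE : pt w = 1 by rewrite /pt /pV So mxE !eqxx.
have eE : pe w = delta_mx l ord0.
  apply/colP=> k; rewrite mxE /pV So !mxE !eqxx !andbT; by case: (k == l).
have AE : pA w = delta_mx l l.
  apply: pA_recover; rewrite ?trmx_delta ?eE ?tE ?scale1r ?mul_delta_mx //.
  by move=> k m _ _; rewrite /pV So.
have SF : symU (pF w) = symU w.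
  by apply/funext=> j; rewrite symU_pF; case: eqP => // ->; rewrite AE So.
have Sl j : symU w j *m delta_mx l ord0 = delta_mx (tperm o l j) ord0 :> 'cV[R]_n.
  have -> : symU w j *m delta_mx l ord0 = col l (symU w j) by rewrite colE.
  rewrite SE; apply/colP=> k; rewrite !mxE !eqxx !andbT.
  have [->|kj] := eqVneq k (tperm o l j); rewrite ?eqxx //=.
  by move: kj; have [->|//] := eqVneq k l => /negPf ->.
have BE : Bmx (symU w) (delta_mx l ord0) = perm_mx (tperm o l).
  apply/matrixP=> i j; rewrite mxE Sl !mxE !eqxx andbT; congr (nat_of_bool _)%:R.
  by rewrite -[in RHS](inj_eq (@perm_inj _ (tperm o l))) tpermK.
rewrite /ph SF eE tE AE BE det_perm trmx_delta mul_delta_mx subrK det1 mulr1.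
by rewrite signr_eq0.
Qed.

Lemma generic_eigen_chart : exists P,
  [/\ polyfun P, exists v : coefT n -> R, P v != 0 &
    forall v, P v != 0 -> forall theta (e : 'cV[R]_n), e l ord0 = 1 ->
    symU v o *m e = theta *: e ->
    \det (Bmx (symU v) e) != 0 /\ \det (theta%:M - symU v o + e *m e^T) != 0].
Proof.
have [P [hP P0 PF]] := polyfun_elimination pF_poly ph_poly
  (ex_intro (fun v => ph v != 0) w ph_w).
exists P; split=> // k Pk theta e el Me.
(* The inverse of the chart: [theta] and [e] are written over row and column [l]. *)
pose Vt : 'M[R]_n := \matrix_(i, m)
  if m == l then (if i == l then theta else e i ord0)
  else if i == l then e m ord0 else symU k o i m.
have Vs : Vt^T = Vt.
  have Ss i m : symU k o i m = symU k o m i by rewrite -[in LHS]symU_tr mxE.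
  apply/matrixP=> i m; rewrite [LHS]mxE [LHS]mxE [RHS]mxE Ss.
  by case: (eqVneq i l) => il; case: (eqVneq m l) => ml; rewrite ?il ?ml.
pose v (c : coefT n) : R := match c with
  | inl (inl (j, i, m)) => if (j == o) && (i <= m)%N then Vt i m else k c
  | _ => k c
  end.
have VE : symU v o = Vt.
  by apply: symUE => // i m im; rewrite /= eqxx im.
have tE : pt v = theta by rewrite /pt /pV VE mxE eqxx.
have eE : pe v = e.
  apply/colP=> i; rewrite mxE /pV VE mxE eqxx.
  by case: eqP => // ->.
have AE : pA v = symU k o.
  apply: pA_recover; rewrite ?symU_tr ?eE ?tE // => i m il ml.
  by rewrite /pV VE mxE (negPf il) (negPf ml).
have FE : pF v = k.
  apply/funext=> -[[[[j i] m]|c]|c] //=.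
  case: ifP => [/andP[/eqP -> im]|-> //].
  by rewrite AE mxE im.
have := PF v; rewrite /ph FE eE tE AE => /(_ Pk).
by rewrite mulf_eq0 negb_or => /andP.
Qed.

End GenericEigenvectors.

(** A nonzero vector has a nonzero coordinate, so the product over [l] of the chart polynomials
    covers all pairs and eigenvectors. The conditions on eigenvectors of [A o] serve to find one
    good boundary point. *)
Lemma generic_data (R : realType) (n : nat) (o : 'I_n) :
  exists P : {mpoly R[#|{: coefT n}|]},
    (exists (A0 : 'I_n -> 'M[R]_n) (a0 : 'I_n -> 'cV[R]_n) (al0 : 'I_n -> R),
        (forall i, (A0 i)^T = A0 i) /\ P.@[coords A0 a0 al0] != 0) /\
    (forall (A : 'I_n -> 'M[R]_n) (a : 'I_n -> 'cV[R]_n) (al : 'I_n -> R),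
        (forall i, (A i)^T = A i) ->
        P.@[coords A a al] != 0 ->
        (forall x d : 'cV[R]_n, d != 0 ->
          (forall j, (x^T *m A j *m x) ord0 ord0 + 2 * ((a j)^T *m x) ord0 ord0 + al j = 0) ->
          (forall j, (d^T *m A j *m d) ord0 ord0
                     + 2 * (d^T *m (A j *m x + a j)) ord0 ord0 = 0) ->
          [/\ \det (Jmx A a x) != 0, \det (Bmx A d) != 0 & \det (corank1_mx A d) != 0]) /\
        (forall theta (e : 'cV[R]_n) l, e l ord0 = 1 -> A o *m e = theta *: e ->
          \det (Bmx A e) != 0 /\ \det (theta%:M - A o + e *m e^T) != 0)).
Proof.
have /fin_all_exists[P1 hP1] l := @generic_pair_chart R n l.
have /fin_all_exists[P2 hP2] l := @generic_eigen_chart R n o l.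
pose Q v := \prod_l P1 l v * \prod_l P2 l v.
have P1p : polyfun (fun v => \prod_l P1 l v) by apply: polyof_prod => l; case: (hP1 l).
have P2p : polyfun (fun v => \prod_l P2 l v) by apply: polyof_prod => l; case: (hP2 l).
have [k0 Qk0] : exists k0, Q k0 != 0.
  by apply: polyfunM_neq0 => //; apply: polyfun_prod_neq0 => l;
    [case: (hP1 l)|case: (hP1 l)|case: (hP2 l)|case: (hP2 l)].
(* [Q] may involve the dummy lower coefficients. Freezing them at their values in [k0] ensures that
   the symmetric data built from [k0] still give the nonzero value [Q k0]. *)
pose psi (v : coefT n -> R) (c : coefT n) : R := match c with
  | inl (inl (j, k, m)) => if (k <= m)%N then v c else k0 c
  | _ => v c
  end.
have psi_poly c : polyfun (fun v => psi v c).
  case: c => [[[[j k] m]|c]|c]; try exact: polyfun_coord.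
  by rewrite /=; case: (k <= m)%N; [apply: polyfun_coord|apply: polyfun_cst].
have [P PE] : polyfun (fun v => Q (psi v)).
  by apply: polyfun_comp => //; apply: polyofM.
have PcE A a al : P.@[coords A a al] = Q (psi (coef_of A a al)) by rewrite PE.
exists P; split.
  exists (symU k0), (acol k0), (fun j => k0 (inr j)); split; first exact: symU_tr.
  rewrite PcE; congr (Q _ != 0): Qk0; apply/funext=> -[[[[j k] m]|[j i]]|j] //=.
    by case: ifP => // km; rewrite mxE km.
  by rewrite mxE.
move=> A a al As; rewrite PcE; set v := psi _ => Qv.
have SE : symU v = A.
  by apply/funext=> j; apply: symUE => // k m km; rewrite /v /= km.
have aE : acol v = a by apply/funext=> j; apply/colP=> i; rewrite mxE.
move: Qv; rewrite mulf_eq0 negb_or => /andP[/prodf_neq0 Q1 /prodf_neq0 Q2]; split.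
  move=> x d d0 H1 H2.
  have [l dl] : exists l, d l ord0 != 0.
    apply/existsP; apply: contraNT d0 => /existsPn d0; apply/eqP/colP=> i.
    by rewrite mxE; apply/eqP; rewrite -[_ == _]negbK d0.
  case: (hP1 l) => _ _ /(_ v (Q1 l isT) x d dl); rewrite SE aE; exact.
move=> theta e l el Ae.
by case: (hP2 l) => _ _ /(_ v (Q2 l isT) theta e el); rewrite SE; apply.
Qed.

(** * First-order jets of rational curves *)

Section Jets.
Variable R : realType.
Implicit Types (f g : R -> R).

(* [f] coincides with [a + b t + O(t^2)], the remainder being a rational
   function regular at 0; at the poles the identity holds trivially. *)
Definition jet f (a b : R) := exists e q : {poly R},
  e.[0] != 0 /\ forall t, f t * e.[t] = (a + b * t) * e.[t] + t ^+ 2 * q.[t].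

Lemma jet_ext f g a b : f =1 g -> jet f a b -> jet g a b.
Proof. by move=> fg [e [q [e0 fE]]]; exists e, q; split=> // t; rewrite -fg. Qed.

Lemma jet_line a b : jet (fun t => a + b * t) a b.
Proof. by exists 1, 0; split=> [|t]; rewrite !hornerE ?oner_neq0. Qed.

Lemma jet_cst a : jet (fun=> a) a 0.
Proof. by apply: jet_ext (jet_line a 0) => t; rewrite mul0r addr0. Qed.

Lemma jetD f g a b c d : jet f a b -> jet g c d -> jet (fun t => f t + g t) (a + c) (b + d).
Proof.
move=> [e1 [q1 [e10 E1]]] [e2 [q2 [e20 E2]]].
exists (e1 * e2), (q1 * e2 + q2 * e1); split=> [|t]; first by rewrite hornerM mulf_neq0.
have -> : (f t + g t) * (e1 * e2).[t] = f t * e1.[t] * e2.[t] + g t * e2.[t] * e1.[t].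
  by rewrite hornerM; ring.
by rewrite E1 E2 hornerD !hornerM; ring.
Qed.

Lemma jetM f g a b c d : jet f a b -> jet g c d ->
  jet (fun t => f t * g t) (a * c) (b * c + a * d).
Proof.
move=> [e1 [q1 [e10 E1]]] [e2 [q2 [e20 E2]]].
exists (e1 * e2), ((a%:P + b *: 'X) * e1 * q2 + q1 * (c%:P + d *: 'X) * e2 + 'X^2 * q1 * q2
  + (b * d) *: (e1 * e2)).
split=> [|t]; first by rewrite hornerM mulf_neq0.
have -> : f t * g t * (e1 * e2).[t] = f t * e1.[t] * (g t * e2.[t]) by rewrite hornerM; ring.
rewrite E1 E2 !(hornerD, hornerM, hornerZ, hornerX, hornerC, hornerXn); ring.
Qed.

(** The interval may be far from 0: after clearing the denominator, vanishing there becomes a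
    polynomial identity, from which both coefficients are read off at 0. *)
Lemma jet_eq0 f a b (c1 c2 : R) : jet f a b -> c1 < c2 ->
  (forall t, c1 < t -> t < c2 -> f t = 0) -> a = 0 /\ b = 0.
Proof.
move=> [e [q [e0 fE]]] c12 f0.
have r0 : (a%:P + b *: 'X) * e + 'X^2 * q = 0.
  apply: (poly_eq0_itv c12) => t t1 t2.
  by have := fE t; rewrite f0 // mul0r !hornerE => <-.
have a0 : a = 0.
  have /eqP : a * e.[0] = 0.
    have := congr1 (fun p : {poly R} => p.[0]) r0.
    rewrite !(hornerD, hornerM, hornerZ, hornerX, hornerC, hornerXn) => E.
    by rewrite -[RHS]E; ring.
  by rewrite mulf_eq0 (negPf e0) orbF => /eqP.
split=> //.
have : 'X * (b *: e + 'X * q) = 0.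
  rewrite -[RHS]r0 a0 polyC0 add0r expr2 -scalerAl; rewrite mulrDr -scalerAr; ring.
move/eqP; rewrite mulf_eq0 polyX_eq0 /= => /eqP /(congr1 (fun p : {poly R} => p.[0])).
rewrite !(hornerD, hornerM, hornerZ, hornerX, hornerC) mul0r addr0 => /eqP.
by rewrite mulf_eq0 (negPf e0) orbF => /eqP.
Qed.

(** Derivatives are computed by comparing two expansions of the same function, the formal gradient
    entering through [jet_meval]. *)
Lemma jet_unique f a b c d : jet f a b -> jet f c d -> a = c /\ b = d.
Proof.
move=> h1 h2; have h := jetD h1 (jetM (jet_cst (-1)) h2).
have [] := @jet_eq0 _ _ _ 0 1 h ltr01.
  by move=> t _ _; rewrite mulN1r subrr.
by rewrite mul0r add0r !mulN1r => /subr0_eq -> /subr0_eq ->.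
Qed.

Section Meval.
Variables (n : nat) (F : 'I_n -> R -> R) (u w : 'I_n -> R).
Hypothesis hF : forall i, jet (F i) (u i) (w i).

Let ok (p : {mpoly R[n]}) :=
  jet (fun t => p.@[F^~ t]) p.@[u] (\sum_(i < n) (mderiv i p).@[u] * w i).

Let okC c : ok c%:MP.
Proof.
rewrite /ok mevalC big1 => [|i _]; last by rewrite mderivC meval0 mul0r.
by apply: jet_ext (jet_cst c) => t; rewrite mevalC.
Qed.

Let okX i : ok 'X_i.
Proof.
rewrite /ok mevalXU (bigD1 i) //= big1 => [|j ji]; last first.
  by rewrite mderivX mnm1E eq_sym (negPf ji) scale0r meval0 mul0r.
have -> : mderiv i ('X_i : {mpoly R[n]}) = 1 by rewrite mderivX mnm1E eqxx scale1r -[X in (X - _)%MM]add0m addmK mpolyX0.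
rewrite meval1 mul1r addr0.
by apply: jet_ext (hF i) => t; rewrite mevalXU.
Qed.

Let okD p q : ok p -> ok q -> ok (p + q).
Proof.
move=> hp hq; rewrite /ok mevalD.
under eq_bigr do rewrite mderivD mevalD mulrDl.
by rewrite big_split; apply: jet_ext (jetD hp hq) => t; rewrite mevalD.
Qed.

Let okM p q : ok p -> ok q -> ok (p * q).
Proof.
move=> hp hq; rewrite /ok mevalM.
have -> : \sum_(i < n) (mderiv i (p * q)).@[u] * w i =
  (\sum_(i < n) (mderiv i p).@[u] * w i) * q.@[u] +
  p.@[u] * (\sum_(i < n) (mderiv i q).@[u] * w i).
  rewrite mulr_suml mulr_sumr -big_split; apply: eq_bigr => i _ /=.
  by rewrite mderivM mevalD !mevalM; ring.
by apply: jet_ext (jetM hp hq) => t; rewrite mevalM.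
Qed.

(** The chain rule: [ok] holds for constants and variables and is stable under sums and products. *)
Lemma jet_meval p : jet (fun t => p.@[F^~ t]) p.@[u] (\sum_(i < n) (mderiv i p).@[u] * w i).
Proof.
rewrite -/(ok p); elim/mpolyind: p => [|c m p _ _ IH]; first by rewrite -mpolyC0; apply: okC.
apply: okD => //; rewrite -mul_mpolyC; apply: okM; first exact: okC.
rewrite mpolyXE_id; elim/big_ind: _ => [||i _]; [by rewrite -mpolyC1; apply: okC|exact: okM|].
elim: (m i) => [|k IHk]; first by rewrite expr0 -mpolyC1; apply: okC.
by rewrite exprS; apply: okM.
Qed.

End Meval.
End Jets.

(** * Definite matrices and the boundary of the spectrahedron *)

Section QuadraticForms.
Variables (R : realType) (n : nat).
Implicit Types (M N : 'M[R]_n) (u v w : 'cV[R]_n).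

Definition dot u v : R := (u^T *m v) ord0 ord0.
Definition psd M := forall v, 0 <= dot v (M *m v).

Lemma dotE u v : dot u v = \sum_i u i ord0 * v i ord0.
Proof. by rewrite /dot mxE; apply: eq_bigr => i _; rewrite mxE. Qed.

Lemma dotC u v : dot u v = dot v u.
Proof. by rewrite !dotE; apply: eq_bigr => i _; rewrite mulrC. Qed.

Lemma dotDr u v w : dot u (v + w) = dot u v + dot u w.
Proof. by rewrite /dot mulmxDr mxE. Qed.

Lemma dotDl u v w : dot (u + v) w = dot u w + dot v w.
Proof. by rewrite dotC dotDr ![dot w _]dotC. Qed.

Lemma dotZr c u v : dot u (c *: v) = c * dot u v.
Proof. by rewrite /dot -scalemxAr mxE. Qed.

Lemma dotZl c u v : dot (c *: u) v = c * dot u v.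
Proof. by rewrite dotC dotZr dotC. Qed.

Lemma dot0r u : dot u 0 = 0.
Proof. by rewrite /dot mulmx0 mxE. Qed.

Lemma dotNr u v : dot u (- v) = - dot u v.
Proof. by rewrite -scaleN1r dotZr mulN1r. Qed.

Lemma dotNl u v : dot (- u) v = - dot u v.
Proof. by rewrite dotC dotNr dotC. Qed.

Lemma dot_trmx M u v : dot u (M *m v) = dot (M^T *m u) v.
Proof. by rewrite /dot trmx_mul trmxK mulmxA. Qed.

Lemma sqnormE u : sqnorm u = dot u u.
Proof. by rewrite dotE; apply: eq_bigr => i _; rewrite expr2. Qed.

Lemma dot_ge0 u : 0 <= dot u u.
Proof. by rewrite dotE; apply: sumr_ge0 => i _; rewrite -expr2 sqr_ge0. Qed.

Lemma dot_eq0 u : dot u u = 0 -> u = 0.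
Proof.
rewrite dotE => /eqP; rewrite psumr_eq0 => [/allP h|i _]; last by rewrite -expr2 sqr_ge0.
apply/colP=> i; rewrite mxE; apply/eqP.
by have := h i (mem_index_enum i); rewrite /= mulf_eq0 orbb.
Qed.

Lemma dot_gt0 u : u != 0 -> 0 < dot u u.
Proof. by move=> u0; rewrite lt_neqAle dot_ge0 andbT eq_sym; apply: contraNneq u0 => /dot_eq0 ->. Qed.

Lemma dot_outer d v : d *m d^T *m v = dot d v *: d.
Proof.
have dE : d^T *m v = (dot d v)%:M by rewrite /dot [LHS]mx11_scalar.
by rewrite -mulmxA dE mul_mx_scalar.
Qed.

Lemma posdefE M : posdef M <-> forall v, v != 0 -> 0 < dot v (M *m v).
Proof. by split=> h v v0; have := h v v0; rewrite /dot mulmxA. Qed.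

Lemma det_neq0_inj M v : \det M != 0 -> M *m v = 0 -> v = 0.
Proof.
move=> dM Mv; have Mu : M \in unitmx by rewrite unitmxE unitfE.
by rewrite -[v](mulKmx Mu) Mv mulmx0.
Qed.

Lemma det_eq0_kernel M : \det M = 0 -> exists2 v : 'cV[R]_n, v != 0 & M *m v = 0.
Proof.
move=> dM; have /det0P[v v0 vM] : \det M^T == 0 by rewrite det_tr dM.
exists v^T; first by rewrite trmx_eq0.
by rewrite -[M]trmxK -trmx_mul vM trmx0.
Qed.

(** At [v - s *: y] the form equals [- 2 s k + s^2 c], negative for small positive [s] unless
    [k = 0]. The choice [s = k / (c + 1)] also covers [c = 0]. *)
Lemma psd_kernel M v : M^T = M -> psd M -> dot v (M *m v) = 0 -> M *m v = 0.
Proof.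
move=> Ms Mp v0; apply: dot_eq0; set y := M *m v; set k := dot y y.
set c := dot y (M *m y); have c0 : 0 <= c := Mp y.
have k0 : 0 <= k := dot_ge0 y.
have yv : dot v (M *m y) = k by rewrite dot_trmx Ms.
pose s := k / (c + 1).
have sE : s * (c + 1) = k by rewrite /s divfK // gt_eqF // ltr_wpDl.
have s0 : 0 <= s by rewrite divr_ge0 // addr_ge0.
have := Mp (v - s *: y).
rewrite mulmxBr -scalemxAr !(dotDl, dotDr, dotNl, dotNr, dotZl, dotZr) v0 -/y -/k -/c yv.
by move=> h; nra.
Qed.

Lemma psd_posdef M : M^T = M -> psd M -> \det M != 0 -> posdef M.
Proof.
move=> Ms Mp dM; apply/posdefE => v v0; rewrite lt_neqAle Mp andbT eq_sym.
by apply: contraNneq v0 => /(psd_kernel Ms Mp) /(det_neq0_inj dM) ->.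
Qed.

Lemma posdef_psd M : posdef M -> psd M.
Proof.
move/posdefE => h v; have [->|/h /ltW //] := eqVneq v 0.
by rewrite mulmx0 dot0r.
Qed.

Lemma posdef_det M : posdef M -> \det M != 0.
Proof.
move/posdefE => h; apply/eqP => /det_eq0_kernel[v v0 Mv].
by have := h v v0; rewrite Mv dot0r ltxx.
Qed.

Lemma coord_le_dot v i j : `|v i ord0 * v j ord0| <= dot v v.
Proof.
have h k : v k ord0 ^+ 2 <= dot v v.
  rewrite dotE (bigD1 k) //= expr2 lerDl; apply: sumr_ge0 => m _.
  by rewrite -expr2 sqr_ge0.
have := h i; have := h j; rewrite normrM -(real_normK (num_real (v i ord0))) -(real_normK (num_real (v j ord0))).
move: `|v i ord0| `|v j ord0| => a b; nra.
Qed.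

Lemma quad_bound M v : `|dot v (M *m v)| <= (\sum_i \sum_j `|M i j|) * dot v v.
Proof.
rewrite dotE mulr_suml; apply: le_trans (ler_norm_sum _ _ _) _; apply: ler_sum => i _.
rewrite mxE mulr_sumr mulr_suml; apply: le_trans (ler_norm_sum _ _ _) _; apply: ler_sum => j _.
by rewrite mulrCA normrM ler_wpM2l ?normr_ge0 ?coord_le_dot.
Qed.

Lemma norm_mulmx_bound M v : dot (M *m v) (M *m v) <= (\sum_i \sum_j `|(M^T *m M) i j|) * dot v v.
Proof.
have -> : dot (M *m v) (M *m v) = dot v (M^T *m M *m v) by rewrite dot_trmx dotC mulmxA.
exact: le_trans (ler_norm _) (quad_bound _ _).
Qed.

(* Completing the square at [v - s N^-1 v] avoids any compactness argument. *)
Lemma posdef_coercive N : N^T = N -> posdef N ->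
  exists2 c, 0 < c & forall v, c * dot v v <= dot v (N *m v).
Proof.
move=> Ns Np; have dN := posdef_det Np; have Nu : N \in unitmx by rewrite unitmxE unitfE.
pose K := \sum_i \sum_j `|invmx N i j| + 1.
have K0 : 0 < K.
  by rewrite ltr_wpDl // sumr_ge0 // => i _; rewrite sumr_ge0.
exists K^-1; rewrite ?invr_gt0 // => v.
pose y := invmx N *m v.
have Ny : N *m y = v by rewrite mulKVmx.
have yy : dot y v <= K * dot v v.
  rewrite dotC; apply: le_trans (ler_norm _) _; apply: le_trans (quad_bound _ _) _.
  by rewrite ler_wpM2r ?dot_ge0 // lerDl.
have := posdef_psd Np (v - K^-1 *: y).
rewrite mulmxBr -scalemxAr Ny !(dotDl, dotDr, dotNl, dotNr, dotZl, dotZr).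
have -> : dot y (N *m v) = dot v v by rewrite dot_trmx Ns Ny.
have : K^-1 * (K^-1 * dot y v) <= K^-1 * dot v v.
  rewrite ler_pM2l ?invr_gt0 //; by rewrite mulrC ler_pdivrMr // mulrC.
lra.
Qed.

(** As [K] exceeds the number of entries, the perturbation changes the form by at most half of its
    coercivity bound. *)
Lemma posdef_open N : N^T = N -> posdef N ->
  exists2 e, 0 < e & forall N', (forall i j, `|N' i j - N i j| <= e) -> posdef N'.
Proof.
move=> Ns Np; have [c c0 hc] := posdef_coercive Ns Np.
pose K : R := \sum_(i < n) \sum_(j < n) 1 + 1.
have K0 : 0 < K by rewrite ltr_wpDl // sumr_ge0 // => i _; rewrite sumr_ge0.
exists (c / (2 * K)); first by rewrite divr_gt0 // mulr_gt0.
move=> N' hN; apply/posdefE => v v0.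
have -> : N' = N + (N' - N) by rewrite addrC subrK.
rewrite mulmxDl dotDr.
have := quad_bound (N' - N) v; rewrite ler_norml => /andP[h _].
have hs : \sum_i \sum_j `|(N' - N) i j| <= c / (2 * K) * K.
  apply: le_trans (_ : \sum_(i < n) \sum_(j < n) (c / (2 * K) * 1) <= _).
    by apply: ler_sum => i _; apply: ler_sum => j _; rewrite mulr1 !mxE hN.
  under eq_bigr do rewrite -mulr_sumr.
  have cK0 : 0 <= c / (2 * K) by rewrite ltW // divr_gt0 // mulr_gt0.
  by rewrite -mulr_sumr ler_wpM2l // lerDl.
have cK : c / (2 * K) * K = c / 2 by field; rewrite gt_eqF.
have := ler_wpM2r (dot_ge0 v) hs; rewrite cK.
have := hc v; have := mulr_gt0 c0 (dot_gt0 v0); lra.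
Qed.

(** Up to sign [M] takes a positive value, since otherwise its form, hence [M], would be zero. Then
    the [t >= 0] with [1 - t N] semidefinite are bounded, and their supremum belongs to the set; a
    nonzero determinant there would allow a larger [t] by [posdef_open]. *)
Lemma critical_pencil M : M^T = M -> M != 0 ->
  exists2 t, psd (1%:M - t *: M) & \det (1%:M - t *: M) = 0.
Proof.
suff pos (N : 'M[R]_n) v0 : N^T = N -> 0 < dot v0 (N *m v0) ->
    exists2 t, psd (1%:M - t *: N) & \det (1%:M - t *: N) = 0.
  move=> Ms M0; case: (pselect (exists v, 0 < dot v (M *m v))) => [[v]|hn].
    exact: pos.
  have Np : psd (- M).
    by move=> v; rewrite mulNmx dotNr oppr_ge0 leNgt; apply/negP => h; apply: hn; exists v.
  have NMs : (- M)^T = - M by rewrite linearN /= Ms.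
  case: (pselect (exists v, 0 < dot v (- M *m v))) => [[v hv]|hn'].
    have [t] := pos _ _ NMs hv; rewrite scalerN -scaleNr => h1 h2.
    by exists (- t).
  case/eqP: M0; apply/matrixP => i j.
  have Mv v : - M *m v = 0.
    apply: psd_kernel => //; apply/eqP; rewrite eq_le Np andbT leNgt.
    by apply/negP => h; apply: hn'; exists v.
  have := congr1 (fun w : 'cV[R]_n => w i ord0) (Mv (delta_mx j ord0)).
  rewrite mulNmx mxE [in RHS]mxE => /eqP; rewrite oppr_eq0 => /eqP.
  have -> : M *m delta_mx j ord0 = col j M by rewrite colE.
  by rewrite !mxE.
move=> Ns Nv0.
have qE t v : dot v ((1%:M - t *: N) *m v) = dot v v - t * dot v (N *m v).
  by rewrite mulmxBl mul1mx -scalemxAl dotDr dotNr dotZr.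
pose T := [set t : R | 0 <= t /\ psd (1%:M - t *: N)]%classic.
have T0 : T 0 by split=> // v; rewrite scale0r subr0 mul1mx dot_ge0.
have Tub v : 0 < dot v (N *m v) -> ubound T (dot v v / dot v (N *m v)).
  move=> hv t [_ /(_ v)]; rewrite qE subr_ge0 => h.
  by rewrite ler_pdivlMr.
have Ts : has_sup T by split; [exists 0 | exists (dot v0 v0 / dot v0 (N *m v0)); apply: Tub].
have s0 : 0 <= sup T by apply: sup_upper_bound.
have ps : psd (1%:M - sup T *: N).
  move=> v; rewrite qE subr_ge0; have [hv|hv] := ltP 0 (dot v (N *m v)).
    rewrite -ler_pdivlMr //; apply: sup_le_ub; [by exists 0 | exact: Tub].
  by apply: le_trans (dot_ge0 v); rewrite mulr_ge0_le0.
exists (sup T) => //; apply/eqP/negPn/negP => dn.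
have sy : (1%:M - sup T *: N)^T = 1%:M - sup T *: N.
  by rewrite linearB /= linearZ /= trmx1 Ns.
have [e e0 he] := posdef_open sy (psd_posdef sy ps dn).
pose K := \sum_i \sum_j `|N i j| + 1.
have K0 : 0 < K by rewrite ltr_wpDl // sumr_ge0 // => i _; rewrite sumr_ge0.
have Tt : T (sup T + e / K).
  split; first by rewrite addr_ge0 // ltW // divr_gt0.
  apply/posdef_psd/he => i j; rewrite !mxE.
  have -> : (i == j)%:R - (sup T + e / K) * N i j - ((i == j)%:R - sup T * N i j) = - (e / K * N i j).
    by ring.
  have eK0 : 0 <= e / K by rewrite ltW // divr_gt0.
  rewrite normrN normrM ger0_norm // mulrAC ler_pdivrMr // ler_pM2l //.
  rewrite /K (bigD1 i) //= (bigD1 j) //= -!addrA lerDl !addr_ge0 // sumr_ge0 // => k _.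
  by rewrite sumr_ge0.
have := sup_upper_bound Ts Tt; rewrite gerDl leNgt divr_gt0 //.
Qed.

End QuadraticForms.

(** * Local behaviour of polynomial functions of one variable *)

Section Continuity.
Variable R : realType.

Definition hev (t : R) : {rmorphism {poly R} -> R} := horner_eval t.

Lemma polyof_id : polyof hev (fun t => t).
Proof. by exists 'X => t; rewrite /= /horner_eval hornerX. Qed.

Lemma polyof_cst c : polyof hev (fun=> c).
Proof. by exists c%:P => t; rewrite /= /horner_eval hornerC. Qed.

Lemma polymx_cst m n (M : 'M[R]_(m, n)) : polymx hev (fun=> M).
Proof. by move=> i j; apply: polyof_cst. Qed.

Lemma polyof_factor f : polyof hev f -> exists q : {poly R}, forall t, f t = f 0 + t * q.[t].
Proof.
move=> [p fp]; have /factor_theorem[q pq] : root (p - p.[0]%:P) 0.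
  by rewrite /root hornerD hornerN hornerC subrr.
exists q => t; rewrite !fp /= /horner_eval.
have := congr1 (fun r : {poly R} => r.[t]) pq.
rewrite hornerM !hornerD !hornerN hornerX !hornerC subr0 => E.
by rewrite [t * _]mulrC -E addrC subrK.
Qed.

Lemma polyof_lipschitz f : polyof hev f ->
  exists C, 0 <= C /\ forall t, `|t| <= 1 -> `|f t - f 0| <= C * `|t|.
Proof.
move=> /polyof_factor[q fq]; exists (\sum_(i < size q) `|q`_i|); split=> [|t t1].
  exact: sumr_ge0.
rewrite fq [f 0 + _]addrC addrK normrM mulrC ler_wpM2r //.
rewrite horner_coef; apply: le_trans (ler_norm_sum _ _ _) _; apply: ler_sum => i _.
by rewrite normrM ler_piMr // normrX exprn_ile1.
Qed.

Lemma polyof_near f e : polyof hev f -> 0 < e ->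
  exists2 r, 0 < r & forall t, `|t| < r -> `|f t - f 0| < e.
Proof.
move=> /polyof_lipschitz[C [C0 hC]] e0; exists (Num.min 1 (e / (C + 1))).
  by rewrite lt_min ltr01 divr_gt0 // ltr_wpDl.
move=> t; rewrite lt_min => /andP[t1 t2].
apply: le_lt_trans (hC _ (ltW t1)) _.
rewrite ltr_pdivlMr ?ltr_wpDl // in t2.
have := normr_ge0 t; nra.
Qed.

Lemma polyof_near_neq0 f : polyof hev f -> f 0 != 0 ->
  exists2 r, 0 < r & forall t, `|t| < r -> f t != 0.
Proof.
move=> fp f0; have [|r r0 hr] := polyof_near fp (e := `|f 0|); first by rewrite normr_gt0.
exists r => // t /hr; apply: contraTneq => ->; rewrite sub0r normrN ltxx //.
Qed.

Lemma polymx_near m n (M : R -> 'M[R]_(m, n)) e : polymx hev M -> 0 < e ->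
  exists2 r, 0 < r & forall t, `|t| < r -> forall i j, `|M t i j - M 0 i j| <= e.
Proof.
move=> hM e0.
have /fin_all_exists[C hC] (ij : 'I_m * 'I_n) := polyof_lipschitz (hM ij.1 ij.2).
pose K := \sum_ij C ij.
have K0 : 0 <= K by apply: sumr_ge0 => ij _; case: (hC ij).
exists (Num.min 1 (e / (K + 1))); first by rewrite lt_min ltr01 divr_gt0 // ltr_wpDl.
move=> t; rewrite lt_min => /andP[t1 t2] i j.
have [_ /(_ t (ltW t1)) /= h] := hC (i, j); apply: le_trans h _.
have CK : C (i, j) <= K.
  by rewrite /K (bigD1 (i, j)) //= lerDl; apply: sumr_ge0 => ij _; case: (hC ij).
rewrite ltr_pdivlMr ?ltr_wpDl // in t2.
have := normr_ge0 t; nra.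
Qed.

(** Multiplying the denominator of the jet by [h] makes the identity trivial at the zeros of [h],
    where [f] and [g] may differ. *)
Lemma jet_local (f g : R -> R) (a b : R) (h : R -> R) : polyof hev h -> h 0 != 0 ->
  (forall t, h t != 0 -> f t = g t) -> jet g a b -> jet f a b.
Proof.
move=> [e he] h0 fg [e1 [q [e10 gE]]].
have hE t : h t = e.[t] by rewrite he.
exists (e1 * e), (q * e); split=> [|t]; first by rewrite hornerM mulf_neq0 // -hE.
rewrite !hornerM; have [e0|e0] := eqVneq e.[t] 0; first by rewrite e0 !mulr0 addr0.
by rewrite mulrA fg ?hE // gE; ring.
Qed.

Lemma jet_tM (k : R -> R) : polyof hev k -> jet (fun t => t * k t) 0 (k 0).
Proof.
move=> /polyof_factor[q kq]; exists 1, q; split=> [|t]; first by rewrite hornerC oner_neq0.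
by rewrite hornerC kq; ring.
Qed.

End Continuity.

(** * The pencil, the boundary of the spectrahedron and the map [lamof] *)

Section Spectrahedron.
Variables (R : realType) (n : nat) (A : 'I_n -> 'M[R]_n).
Hypothesis As : forall i, (A i)^T = A i.
Implicit Types (lam mu d v : 'cV[R]_n).

Definition pencil lam : 'M[R]_n := 1%:M - lcomb A lam.

Lemma lcombD lam mu : lcomb A (lam + mu) = lcomb A lam + lcomb A mu.
Proof. by rewrite -big_split; apply: eq_bigr => i _; rewrite mxE scalerDl. Qed.

Lemma lcombZ c lam : lcomb A (c *: lam) = c *: lcomb A lam.
Proof. by rewrite scaler_sumr; apply: eq_bigr => i _; rewrite mxE scalerA. Qed.

Lemma lcombB lam mu : lcomb A (lam - mu) = lcomb A lam - lcomb A mu.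
Proof. by rewrite lcombD -scaleN1r lcombZ scaleN1r. Qed.

Lemma lcomb_tr lam : (lcomb A lam)^T = lcomb A lam.
Proof. by rewrite linear_sum; apply: eq_bigr => i _; rewrite linearZ /= As. Qed.

Lemma pencil_tr lam : (pencil lam)^T = pencil lam.
Proof. by rewrite /pencil linearB /= trmx1 lcomb_tr. Qed.

Lemma lcomb_mul lam v : lcomb A lam *m v = Bmx A v *m lam.
Proof.
apply/colP=> i; rewrite mulmx_suml summxE mxE; apply: eq_bigr => j _.
by rewrite -scalemxAl mxE [Bmx _ _ _ _]mxE mulrC.
Qed.

Lemma pencil_mul lam v : pencil lam *m v = v - Bmx A v *m lam.
Proof. by rewrite mulmxBl mul1mx lcomb_mul. Qed.

Lemma pencil_line lam mu t : pencil (lam + t *: mu) = pencil lam - t *: lcomb A mu.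
Proof. by rewrite /pencil lcombD lcombZ opprD addrA. Qed.

Lemma BmxD d v : Bmx A (d + v) = Bmx A d + Bmx A v.
Proof. by apply/matrixP=> i j; rewrite [LHS]mxE mulmxDr mxE [RHS]mxE !mxE. Qed.

Lemma BmxZ c d : Bmx A (c *: d) = c *: Bmx A d.
Proof. by apply/matrixP=> i j; rewrite [LHS]mxE -scalemxAr mxE [RHS]mxE !mxE. Qed.

Lemma coord_le_norm v i (e : R) : 0 < e -> sqnorm v < e ^+ 2 -> `|v i ord0| <= e.
Proof.
move=> e0 h; have := coord_le_dot v i i; rewrite -sqnormE normrM => h'.
have := normr_ge0 (v i ord0); nra.
Qed.

(** A negative value of the form persists nearby, which excludes nearby points of the spectrahedron.
    A semidefinite pencil with nonzero determinant is definite and remains so nearby, which excludes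
    nearby points of the complement. *)
Lemma topbd_Sed_pencil lam : topbd (Sed A) lam -> psd (pencil lam) /\ \det (pencil lam) = 0.
Proof.
move=> bd.
have ps : psd (pencil lam).
  move=> v; rewrite leNgt; apply/negP => hv.
  pose C := \sum_j `|dot v (A j *m v)| + 1.
  have C0 : 0 < C by rewrite ltr_wpDl // sumr_ge0.
  have [] := bd (- dot v (pencil lam *m v) / C); first by rewrite divr_gt0 // oppr_gt0.
  move=> [mu [/posdef_psd /(_ v)]] h hmu _.
  have e0 : 0 < - dot v (pencil lam *m v) / C by rewrite divr_gt0 // oppr_gt0.
  have : `|dot v (lcomb A (mu - lam) *m v)| <= (- dot v (pencil lam *m v) / C) * (C - 1).
    have -> : dot v (lcomb A (mu - lam) *m v) = \sum_j (mu - lam) j ord0 * dot v (A j *m v).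
      rewrite /lcomb mulmx_suml /dot mulmx_sumr summxE; apply: eq_bigr => j _.
      by rewrite -scalemxAl -scalemxAr mxE.
    rewrite /C addrK mulr_sumr; apply: le_trans (ler_norm_sum _ _ _) _; apply: ler_sum => j _.
    by rewrite normrM ler_wpM2r //; apply: coord_le_norm.
  have -> : dot v (lcomb A (mu - lam) *m v) = dot v (pencil lam *m v) - dot v (pencil mu *m v).
    rewrite lcombB !mulmxBl !mul1mx.
    by rewrite !dotDr !dotNr; ring.
  rewrite ler_norml => /andP[h1 _].
  have CE : - dot v (pencil lam *m v) / C * (C - 1) = - dot v (pencil lam *m v) - (- dot v (pencil lam *m v) / C).
    by field; rewrite gt_eqF.
  move: h h1 e0; rewrite CE; set q := _ / C; rewrite -/(pencil mu); lra.
split=> //; apply/eqP/negPn/negP => dn.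
have [e e0 he] := posdef_open (pencil_tr lam) (psd_posdef (pencil_tr lam) ps dn).
pose C := \sum_j \sum_i \sum_k `|A j i k| + 1.
have C0 : 0 < C by rewrite ltr_wpDl // !sumr_ge0 // => j _; rewrite sumr_ge0 // => i _; rewrite sumr_ge0.
have [] := bd (e / C); first by rewrite divr_gt0.
move=> _ [mu [nS hmu]]; apply: nS; apply: he => i k.
have -> : (1%:M - \sum_(j < n) mu j ord0 *: A j) i k - pencil lam i k = - \sum_j (mu - lam) j ord0 * A j i k.
  have -> : \sum_j (mu - lam) j ord0 * A j i k = lcomb A (mu - lam) i k.
    by rewrite summxE; apply: eq_bigr => j _; rewrite !mxE.
  by rewrite -/(lcomb A mu) lcombB !mxE; ring.
rewrite normrN; apply: le_trans (ler_norm_sum _ _ _) _.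
apply: le_trans (_ : \sum_j e / C * `|A j i k| <= _).
  apply: ler_sum => j _; rewrite normrM ler_wpM2r //; apply: coord_le_norm => //.
  by rewrite divr_gt0.
rewrite -mulr_sumr mulrAC ler_pdivrMr // ler_pM2l //.
apply: (@le_trans _ _ (\sum_j \sum_i \sum_k `|A j i k|)); last by rewrite lerDl.
apply: ler_sum => j _; rewrite (bigD1 i) //= (bigD1 k) //= -addrA lerDl addr_ge0 ?sumr_ge0 // => m _.
by rewrite sumr_ge0.
Qed.

(** The pencil at [(1 - s) *: lam] is [1 - s] times that at [lam] plus [s] times the identity, hence
    definite: shrinking towards the origin enters the spectrahedron, while [lam] itself is
    outside. *)
Lemma pencil_topbd_Sed lam : psd (pencil lam) -> \det (pencil lam) = 0 -> topbd (Sed A) lam.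
Proof.
move=> ps d0 e e0; split; last first.
  exists lam; split; last by rewrite subrr sqnormE dot0r exprn_gt0.
  by move/posdef_det; rewrite -/(lcomb A lam) -/(pencil lam) d0 eqxx.
pose s := Num.min 1 (e / (dot lam lam + 1)).
have K0 : 0 < dot lam lam + 1 by rewrite ltr_wpDl // dot_ge0.
have s0 : 0 < s by rewrite lt_min ltr01 divr_gt0.
have s1 : s <= 1 by rewrite ge_min lexx.
have se : s * (dot lam lam + 1) <= e by rewrite -ler_pdivlMr // ge_min lexx orbT.
exists ((1 - s) *: lam); split.
  rewrite /Sed -/(lcomb A _); apply/posdefE => v v0.
  have qE mu : dot v ((1%:M - lcomb A mu) *m v) = dot v v - dot v (lcomb A mu *m v).
    by rewrite mulmxBl mul1mx dotDr dotNr.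
  have := ps v; have := dot_gt0 v0; rewrite !qE lcombZ -scalemxAl dotZr; nra.
rewrite -{2}[lam]scale1r -scalerBl sqnormE dotZl dotZr.
have -> : 1 - s - 1 = - s by ring.
move: se K0 (dot_ge0 lam); move: (dot lam lam) => L se K0 L0.
have h1 : (s * (L + 1)) ^+ 2 <= e ^+ 2 by apply: lerXn2r; rewrite // nnegrE ltW // mulr_gt0.
have h2 : 0 < s ^+ 2 * (L ^+ 2 + L + 1).
  by rewrite mulr_gt0 ?exprn_gt0 // ltr_wpDl // addr_ge0 // sqr_ge0.
nra.
Qed.

Definition lamof d := invmx (Bmx A d) *m d.

Lemma lamofE d : \det (Bmx A d) != 0 -> Bmx A d *m lamof d = d.
Proof. by move=> dB; rewrite mulKVmx // unitmxE unitfE. Qed.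

Lemma lamof_unique d lam : \det (Bmx A d) != 0 -> Bmx A d *m lam = d -> lam = lamof d.
Proof.
move=> dB E; have Bu : Bmx A d \in unitmx by rewrite unitmxE unitfE.
by rewrite -[lam](mulKmx Bu) E.
Qed.

Lemma lamof_adj d : \det (Bmx A d) != 0 -> \adj (Bmx A d) *m d = \det (Bmx A d) *: lamof d.
Proof.
by move=> dB; rewrite -[X in _ *m X = _](lamofE dB) mulmxA mul_adj_mx mul_scalar_mx.
Qed.

Lemma pencil_lamof d : \det (Bmx A d) != 0 -> pencil (lamof d) *m d = 0.
Proof. by move=> dB; rewrite pencil_mul lamofE // subrr. Qed.

Lemma polymx_ray d v : polymx (@hev R) (fun t => d + t *: v).
Proof.
apply: polymxD; first exact: polymx_cst.
by apply: polymxZ; [apply: polyof_id | apply: polymx_cst].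
Qed.

Lemma polymx_Bray d v : polymx (@hev R) (fun t => Bmx A (d + t *: v)).
Proof.
apply: (@polymx_Bmx _ _ _ _ _ (fun=> A)); last exact: polymx_ray.
by move=> j; apply: polymx_cst.
Qed.

(* [B (d + t v) (lam + t mu) = d + t v + t^2 B v mu] as soon as
   [B d mu = pencil lam v]: this identifies the first-order jet of [lamof]. *)
Lemma jet_lamof d v j : \det (Bmx A d) != 0 ->
  jet (fun t => lamof (d + t *: v) j ord0) (lamof d j ord0)
      ((invmx (Bmx A d) *m (pencil (lamof d) *m v)) j ord0).
Proof.
move=> dB; set mu := invmx _ *m _.
have Bmu : Bmx A d *m mu = pencil (lamof d) *m v by rewrite mulKVmx // unitmxE unitfE.
have hB := @polymx_Bray d v.
pose g t := lamof d j ord0 + mu j ord0 * t.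
have key t : \det (Bmx A (d + t *: v)) != 0 ->
    \det (Bmx A (d + t *: v)) * lamof (d + t *: v) j ord0 = \det (Bmx A (d + t *: v)) * g t
    + t ^+ 2 * - (\adj (Bmx A (d + t *: v)) *m (Bmx A v *m mu)) j ord0.
  move=> dBt; set Bt := Bmx A (d + t *: v).
  have E : Bt *m (lamof d + t *: mu) - t ^+ 2 *: (Bmx A v *m mu) = d + t *: v.
    rewrite /Bt BmxD BmxZ mulmxDl !mulmxDr lamofE // -!scalemxAl -!scalemxAr Bmu pencil_mul.
    move: (Bmx A v *m mu) (Bmx A v *m lamof d) => Y X.
    by apply/colP=> k; rewrite !mxE; ring.
  have := congr1 (fun w => (\adj Bt *m w) j ord0) E.
  rewrite /= lamof_adj // mulmxBr mulmxA mul_adj_mx mul_scalar_mx -scalemxAr => F.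
  have -> : \det Bt * lamof (d + t *: v) j ord0 = (\det Bt *: lamof (d + t *: v)) j ord0.
    by rewrite [RHS]mxE.
  rewrite -F /g [LHS]mxE [X in X + _]mxE [X in _ + X]mxE [X in _ - X]mxE.
  by rewrite [X in _ * X]mxE [X in _ * (_ + X)]mxE; ring.
have [den hden] := polyof_det hB.
have [q hq] : polyof (@hev R) (fun t => - (\adj (Bmx A (d + t *: v)) *m (Bmx A v *m mu)) j ord0).
  by apply: polyofN; apply: polymxM; [apply: polymx_adj | apply: polymx_cst].
have denE t : den.[t] = \det (Bmx A (d + t *: v)) by rewrite hden.
exists (den * den), (den * q); split=> [|t].
  by rewrite hornerM denE scale0r addr0 mulf_neq0.
rewrite !hornerM denE -[q.[t]]/(hev t q) -hq.
have [->|dt] := eqVneq (\det (Bmx A (d + t *: v))) 0; first by rewrite !mul0r !mulr0 addr0.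
by rewrite mulrCA [_ * \det _]mulrC key // /g; ring.
Qed.

End Spectrahedron.

(** * Vanishing and differentiation along the kernel parametrization *)

Section KernelParametrization.
Variables (R : realType) (n : nat) (A : 'I_n -> 'M[R]_n).
Hypothesis As : forall i, (A i)^T = A i.
Implicit Types (lam mu d v : 'cV[R]_n).

Lemma outer_tr d : (d *m d^T)^T = d *m d^T.
Proof. by rewrite trmx_mul trmxK. Qed.

Section Vanishing.
Variables (d0 : 'cV[R]_n).
Hypotheses (dB0 : \det (Bmx A d0) != 0) (d0_neq0 : d0 != 0).
Hypotheses (ps0 : psd (pencil A (lamof A d0))).
Hypothesis ker0 : \det (pencil A (lamof A d0) + d0 *m d0^T) != 0.

(* [M + d0 d0^T] is definite for [M] near the boundary point of [d0], and
   adding the outer product only matters along [d0], which is transverse to the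
   hyperplane on which [M] has to be tested since [M] kills [d0 + s v]. *)
Lemma psd_near v : exists2 r, 0 < r & forall s, `|s| < r ->
  \det (Bmx A (d0 + s *: v)) != 0 /\ psd (pencil A (lamof A (d0 + s *: v))).
Proof.
pose dd s := d0 + s *: v.
have dd0 : dd 0 = d0 by rewrite /dd scale0r addr0.
have hd : polymx (@hev R) dd := polymx_ray d0 v.
have hB : polymx (@hev R) (fun s => Bmx A (dd s)) := polymx_Bray A d0 v.
pose den s := \det (Bmx A (dd s)).
have hden : polyof (@hev R) den by apply: polyof_det.
have [r1 r10 h1] : exists2 r, 0 < r & forall s, `|s| < r -> den s != 0.
  by apply: polyof_near_neq0; rewrite // /den dd0.
have [r2 r20 h2] : exists2 r, 0 < r & forall s, `|s| < r -> dot d0 (dd s) != 0.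
  apply: (@polyof_near_neq0 R (fun s => dot d0 (dd s))); last by rewrite dd0 gt_eqF ?dot_gt0.
  by apply: polymxM => //; apply: polymx_cst.
(* The factor [den s ^+ 2] clears the denominators of [lamof], so the entries are polynomial in
   [s]. *)
pose N s : 'M[R]_n := (den s * den s)%:M - den s *: lcomb A (\adj (Bmx A (dd s)) *m dd s) + d0 *m d0^T.
have NE s : den s != 0 -> N s = (den s ^+ 2) *: pencil A (lamof A (dd s)) + d0 *m d0^T.
  move=> ds; rewrite /N lamof_adj // lcombZ scalerA -expr2 /pencil scalerBr.
  by rewrite -scalemx1.
have hN : polymx (@hev R) N.
  apply: polymxD; last exact: polymx_cst.
  apply: polymxD; first by apply: polymx_scalar; apply: polyofM.
  apply: polymxN; apply: polymxZ => //.
  apply: (@polymx_lcomb _ _ _ _ _ (fun=> A)); first by move=> j; apply: polymx_cst.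
  by apply: polymxM => //; apply: polymx_adj.
have den0 : den 0 != 0 by rewrite /den dd0.
have N0s : (N 0)^T = N 0.
  by rewrite NE // dd0 linearD /= linearZ /= pencil_tr // outer_tr.
have N0p : posdef (N 0).
  apply/posdefE => w w0; rewrite NE // dd0 mulmxDl dotDr dot_outer dotZr [dot w d0]dotC -scalemxAl dotZr.
  have p1 : 0 <= den 0 ^+ 2 * dot w (pencil A (lamof A d0) *m w).
    by rewrite mulr_ge0 ?sqr_ge0.
  have p2 : 0 <= dot d0 w * dot d0 w by rewrite -expr2 sqr_ge0.
  rewrite lt_neqAle addr_ge0 // andbT eq_sym paddr_eq0 // mulf_eq0 expf_eq0 /= (negPf den0) /=.
  rewrite mulf_eq0 orbb; apply: contra w0 => /andP[/eqP q1 /eqP q2].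
  apply/eqP; apply: (det_neq0_inj ker0).
  by rewrite mulmxDl dot_outer q2 scale0r addr0 (psd_kernel _ ps0 q1) // pencil_tr.
have [e e0 he] := posdef_open N0s N0p.
have [r3 r30 h3] := polymx_near hN e0.
exists (Num.min r1 (Num.min r2 r3)); first by rewrite !lt_min r10 r20.
move=> s; rewrite !lt_min => /and3P[/h1 ds /h2 dd2 /h3/he Np]; split=> // w.
pose M := pencil A (lamof A (dd s)).
have Ms : M^T = M by rewrite pencil_tr.
have Md : M *m dd s = 0 by rewrite pencil_lamof.
pose c := dot d0 w / dot d0 (dd s); pose y := w - c *: dd s.
have wE : w = y + c *: dd s by rewrite subrK.
have yd : dot d0 y = 0 by rewrite /y dotDr dotNr dotZr /c divfK // subrr.
have Mw : M *m w = M *m y by rewrite wE mulmxDr -scalemxAr Md scaler0 addr0.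
have dM : dot (dd s) (M *m y) = 0 by rewrite dot_trmx Ms Md dotC dot0r.
rewrite -/(dd s) -/M Mw {1}wE dotDl dotZl dM mulr0 addr0.
have := posdef_psd Np y; rewrite NE // mulmxDl dot_outer yd scale0r addr0 -scalemxAl dotZr.
by rewrite pmulr_rge0 // lt_neqAle sqr_ge0 eq_sym expf_eq0 /= ds.
Qed.

Lemma vanishes_lamof (p : {mpoly R[n]}) d : vanishes_on p (topbd (Sed A)) ->
  \det (Bmx A d) != 0 -> p.@[coordsv (lamof A d)] = 0.
Proof.
move=> pv dB; have [r r0 hr] := psd_near (d - d0).
have J := jet_meval (fun j => jet_lamof (A := A) (d0 - d) j dB) p.
(* On the line from [d] at [t = 0] to [d0] at [t = 1], vanishing is known just before 1 and
   transfers to 0. *)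
have [] // := jet_eq0 (c1 := 1 - r) (c2 := 1) J; first by rewrite gtrBl.
move=> t t1 t2; have sr : `|1 - t| < r by rewrite ger0_norm; lra.
have [dBt pst] := hr _ sr.
have -> : d + t *: (d0 - d) = d0 + (1 - t) *: (d - d0).
  by apply/colP=> k; rewrite !mxE; ring.
apply: (pv (lamof A (d0 + (1 - t) *: (d - d0)))); apply: pencil_topbd_Sed => //.
(* A regular pencil would force its kernel vector to be zero, and [Bmx A 0 = 0] is not
   invertible. *)
apply/eqP/negPn/negP => dM; have dt0 := det_neq0_inj dM (pencil_lamof dBt).
rewrite dt0 in dBt; case/eqP: d0_neq0; apply: (det_neq0_inj dBt).
by rewrite -(scale0r d0) BmxZ !scale0r mul0mx.
Qed.

(** The condition on [mu] makes [M v = B(d) mu] solvable, so that [mu] is the velocity of [lamof]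
    along [d + t v], a curve on which [p] vanishes. The solution comes from inverting [M + d d^T];
    pairing with [d] shows that the added term contributes nothing. *)
Lemma gradient_lamof (p : {mpoly R[n]}) d mu : vanishes_on p (topbd (Sed A)) ->
  d != 0 -> \det (Bmx A d) != 0 -> \det (pencil A (lamof A d) + d *m d^T) != 0 ->
  dot d (Bmx A d *m mu) = 0 ->
  \sum_(i < n) (mderiv i p).@[coordsv (lamof A d)] * mu i ord0 = 0.
Proof.
move=> pv dn0 dB dker dmu.
set M := pencil _ _ in dker; set N := M + _ in dker.
have Bu : Bmx A d \in unitmx by rewrite unitmxE unitfE.
have Md : M *m d = 0 by apply: pencil_lamof.
have Ms : M^T = M by apply: pencil_tr.
pose v := invmx N *m (Bmx A d *m mu).
have Nv : M *m v + dot d v *: d = Bmx A d *m mu.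
  by rewrite -dot_outer -mulmxDl mulKVmx // unitmxE unitfE.
have dv : dot d v = 0.
  have := congr1 (dot d) Nv; rewrite dmu dotDr dot_trmx Ms Md dotC dot0r add0r dotZr => /eqP.
  by rewrite mulf_eq0 [_ == 0 as X in _ || X]gt_eqF ?dot_gt0 // orbF => /eqP.
have muE : invmx (Bmx A d) *m (M *m v) = mu.
  by rewrite -[M *m v]addr0 -(scale0r d) -dv Nv mulKmx.
have J := jet_meval (fun j => jet_lamof (A := A) v j dB) p.
rewrite -/M muE in J.
have dB' : \det (Bmx A (d + 0 *: v)) != 0 by rewrite scale0r addr0.
have [r r0 hr] := polyof_near_neq0 (polyof_det (polymx_Bray A d v)) dB'.
have [] // := jet_eq0 (c1 := 0) (c2 := r) J r0.
move=> t t0 tr; apply: (vanishes_lamof pv (hr t _)).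
by rewrite ger0_norm // ltW.
Qed.

End Vanishing.
(* Sylvester's identity: both triangular factorizations of the block matrix
   [1, v^T; u, 1]. *)
Lemma det_rank1 u v : \det (1%:M - u *m v^T) = 1 - dot v u.
Proof.
have E1 : block_mx 1%:M v^T u 1%:M =
    block_mx (1%:M : 'M[R]_1) 0 u 1%:M *m block_mx 1%:M v^T 0 (1%:M - u *m v^T).
  by rewrite mulmx_block !mul1mx !mul0mx !mulmx1 !addr0 [_ + (_ - _)]addrC subrK.
have E2 : block_mx 1%:M v^T u 1%:M =
    block_mx ((1 - dot v u)%:M : 'M[R]_1) v^T 0 1%:M *m block_mx 1%:M 0 u 1%:M.
  rewrite mulmx_block ?mul1mx ?mul0mx ?mulmx0 ?mulmx1 ?add0r; congr block_mx.
  by rewrite [v^T *m u]mx11_scalar -/(dot v u) -raddfD /= subrK.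
have := E1; rewrite E2 => /(congr1 determinant).
rewrite !det_mulmx !det_ublock !det_lblock !det1 !mulr1 !mul1r det_scalar1.
by move->.
Qed.

(** Near 0 the pencil is the invertible [N t] minus [d d^T], so [det_rank1] gives its determinant.
    The slope shows that the gradient of the determinant is a nonzero multiple of the covector
    [mu |-> d^T B(d) mu]. *)
Lemma jet_det_pencil d lam mu : d != 0 -> pencil A lam *m d = 0 ->
  \det (pencil A lam + d *m d^T) != 0 ->
  jet (fun t => \det (pencil A (lam + t *: mu))) 0
    (- (\det (pencil A lam + d *m d^T) * dot d (lcomb A mu *m d)) / dot d d ^+ 2).
Proof.
move=> dn0 Md dker; set W := lcomb A mu; have dd0 := dot_gt0 dn0.
pose N t := pencil A (lam + t *: mu) + d *m d^T.
have hN : polymx (@hev R) N.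
  apply: polymxD; last exact: polymx_cst.
  apply: polymxD; first exact: polymx_cst.
  apply: polymxN; apply: (@polymx_lcomb _ _ _ _ _ (fun=> A)); last exact: polymx_ray.
  by move=> j; apply: polymx_cst.
(* Wherever [N t] is invertible, [t * k t] is exactly the determinant of the pencil. *)
pose k t := - (dot d (\adj (N t) *m (W *m d)) / dot d d).
have hk : polyof (@hev R) k.
  apply: polyofN; apply: polyofM; last exact: polyof_cst.
  apply: polymxM; first exact: polymx_cst.
  by apply: polymxM; [apply: polymx_adj | apply: polymx_cst].
have N0 : N 0 = pencil A lam + d *m d^T by rewrite /N scale0r addr0.
have Nd t : N t *m d = dot d d *: d - t *: (W *m d).
  by rewrite mulmxDl pencil_line mulmxBl Md sub0r -scalemxAl dot_outer addrC.
have k0 : k 0 = - (\det (N 0) * dot d (W *m d)) / dot d d ^+ 2.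
  have Ns : (N 0)^T = N 0 by rewrite N0 linearD /= pencil_tr // outer_tr.
  have ad : \adj (N 0) *m d = (\det (N 0) / dot d d) *: d.
    have := congr1 (mulmx (\adj (N 0))) (Nd 0).
    rewrite mulmxA mul_adj_mx mul_scalar_mx scale0r subr0 -scalemxAr => E.
    by rewrite mulrC -scalerA E scalerA mulVf ?scale1r // gt_eqF.
  rewrite /k [dot d (\adj _ *m _)]dot_trmx trmx_adj Ns ad dotZl.
  by field; rewrite gt_eqF.
rewrite -N0 -k0; apply: (jet_local (polyof_det hN) _ _ (jet_tM hk)); first by rewrite N0.
move=> t dN; have Nu : N t \in unitmx by rewrite unitmxE unitfE.
have -> : pencil A (lam + t *: mu) = N t *m (1%:M - (invmx (N t) *m d) *m d^T).
  by rewrite mulmxBr mulmx1 !mulmxA mulmxV // mul1mx /N addrK.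
rewrite det_mulmx det_rank1.
have aE : \adj (N t) *m (W *m d) = \det (N t) *: (invmx (N t) *m (W *m d)).
  by rewrite -[X in \adj _ *m X](mulKVmx Nu) [LHS]mulmxA mul_adj_mx mul_scalar_mx.
have : dot d d = dot d d * dot d (invmx (N t) *m d) - t * dot d (invmx (N t) *m (W *m d)).
  have := congr1 (fun w => dot d (invmx (N t) *m w)) (Nd t).
  by rewrite /= mulKmx // mulmxBr -!scalemxAr dotDr dotNr !dotZr.
rewrite /k aE dotZr; move: (dot d (invmx _ *m d)) (dot d (invmx _ *m (W *m d))) => a b E.
have dd1 : dot d d != 0 by rewrite gt_eqF.
have -> : 1 - a = - (t * b) / dot d d.
  apply: (mulfI dd1); rewrite [RHS]mulrC divfK // mulrBr mulr1 [X in X - _]E; ring.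
by field.
Qed.

End KernelParametrization.

(** * Tangency *)

Section Transport.
Variables (R : realType) (n : nat).
Implicit Types (p : {mpoly R[n]}) (u w x d : 'cV[R]_n).

Definition cev u : {rmorphism {mpoly R[n]} -> R} := meval (coordsv u).

Lemma polyof_cev_cst c : polyof cev (fun=> c).
Proof. by exists c%:MP => u; rewrite /= mevalC. Qed.

Lemma polymx_cev_id : polymx cev (fun u => u).
Proof. by move=> i j; exists 'X_i => u; rewrite /= mevalXU /coordsv (ord1 j). Qed.

Lemma affine_comp p (G : 'M[R]_n) x :
  exists q : {mpoly R[n]}, forall u, q.@[coordsv u] = p.@[coordsv (x + G *m u)].
Proof.
have /fin_all_exists[q hq] i : polyof cev (fun u => (x + G *m u) i ord0).
  apply: polymxD; first by move=> *; apply: polyof_cev_cst.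
  by apply: polymxM; [move=> *; apply: polyof_cev_cst | apply: polymx_cev_id].
exists (p \mPo [tuple q i | i < n]) => u.
by rewrite comp_mpoly_meval; apply: meval_eq => i; rewrite tnth_mktuple /coordsv hq.
Qed.

Lemma jet_ray p u w : jet (fun t => p.@[coordsv (u + t *: w)]) p.@[coordsv u]
  (\sum_(i < n) (mderiv i p).@[coordsv u] * w i ord0).
Proof.
apply: jet_ext (jet_meval (fun i => jet_line (u i ord0) (w i ord0)) p) => t.
by apply: meval_eq => i; rewrite /coordsv !mxE mulrC.
Qed.

Lemma topbd_affine_fwd (S : 'cV[R]_n -> Prop) (J : 'M[R]_n) x lam : \det J != 0 ->
  topbd S lam -> topbd (fun u => exists2 l, S l & u = x - J *m l) (x - J *m lam).
Proof.
move=> dJ bd e e0.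
(* [J] multiplies squared norms by at most [K]; as [K >= 1], radius [e / K] suffices. *)
pose K := \sum_i \sum_j `|(J^T *m J) i j| + 1.
have K0 : 1 <= K by rewrite lerDr sumr_ge0 // => i _; rewrite sumr_ge0.
have eK : 0 < e / K by rewrite divr_gt0 // (lt_le_trans _ K0).
have near l : sqnorm (l - lam) < (e / K) ^+ 2 ->
    sqnorm (x - J *m l - (x - J *m lam)) < e ^+ 2.
  have -> : x - J *m l - (x - J *m lam) = - (J *m (l - lam)).
    by rewrite mulmxBr opprB addrC opprB addrA addrNK addrC.
  rewrite !sqnormE dotNl dotNr opprK => h.
  apply: le_lt_trans (norm_mulmx_bound _ _) _.
  apply: le_lt_trans (_ : K * dot (l - lam) (l - lam) < _).
    by rewrite ler_wpM2r ?dot_ge0 // lerDl.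
  have K00 : 0 < K by apply: lt_le_trans K0.
  apply: lt_le_trans (_ : K * (e / K) ^+ 2 <= _); first by rewrite ltr_pM2l.
  rewrite expr_div_n mulrA [K * _]mulrC -mulrA ler_piMr ?sqr_ge0 //.
  by rewrite expr2 invfM mulrA divff ?gt_eqF // mul1r invf_le1.
have [[l [Sl hl]] [m [Sm hm]]] := bd _ eK; split.
  by exists (x - J *m l); split; [exists l | apply: near].
exists (x - J *m m); split; last exact: near.
case=> m' Sm' /addrI /oppr_inj E; apply: Sm.
suff -> : m = m' by [].
apply/eqP; rewrite -subr_eq0; apply/eqP; apply: (det_neq0_inj dJ).
by rewrite mulmxBr E subrr.
Qed.

(** The forward statement applied to the inverse affine map. *)
Lemma topbd_affine_bwd (S : 'cV[R]_n -> Prop) (J : 'M[R]_n) x u : \det J != 0 ->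
  topbd (fun u => exists2 l, S l & u = x - J *m l) u -> topbd S (invmx J *m (x - u)).
Proof.
move=> dJ bd; have Ju : J \in unitmx by rewrite unitmxE unitfE.
have dJi : \det (invmx J) != 0 by rewrite det_inv invr_neq0.
have := topbd_affine_fwd (invmx J *m x) dJi bd; rewrite -mulmxBr.
suff -> : (fun l => exists2 u, (exists2 l, S l & u = x - J *m l) &
    l = invmx J *m x - invmx J *m u) = S by [].
apply/funext => l; apply/propext; split=> [[_ [m Sm ->] ->]|Sl].
  by rewrite -mulmxBr opprB addrC subrK mulKmx.
exists (x - J *m l); first by exists l.
by rewrite -mulmxBr opprB addrC subrK mulKmx.
Qed.

End Transport.

(** * Tangent spaces of the algebraic boundaries and of the bisector *)

Section Tangency.
Variables (R : realType) (n : nat).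
Variables (A : 'I_n -> 'M[R]_n) (a : 'I_n -> 'cV[R]_n) (al : 'I_n -> R).
Hypothesis As : forall i, (A i)^T = A i.
Implicit Types (x d u w : 'cV[R]_n).

Lemma fpolyE j x : (fpoly A a al j).@[coordsv x] = dot x (A j *m x) + 2 * dot (a j) x + al j.
Proof.
rewrite /fpoly !mevalD mevalC; congr (_ + _ + _).
  rewrite raddf_sum dotE; apply: eq_bigr => k _; rewrite raddf_sum mxE mulr_sumr.
  apply: eq_bigr => l _; rewrite /= !mevalM mevalC !mevalXU /coordsv; ring.
rewrite raddf_sum dotE mulr_sumr; apply: eq_bigr => k _.
by rewrite /= mevalM mevalC mevalXU /coordsv; ring.
Qed.

Lemma fpoly_line j x w t : (fpoly A a al j).@[coordsv (x + t *: w)] =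
  (fpoly A a al j).@[coordsv x] + 2 * dot w (A j *m x + a j) * t + t ^+ 2 * dot w (A j *m w).
Proof.
rewrite !fpolyE mulmxDr -scalemxAr !(dotDl, dotDr, dotZl, dotZr) [dot (a j) w]dotC.
have -> : dot x (A j *m w) = dot w (A j *m x) by rewrite dot_trmx As dotC.
by rewrite [dot (a j) x]dotC; ring.
Qed.

Lemma JacfE x : Jacf A a al x = 2 *: Jmx A a x.
Proof.
apply/matrixP=> i j; rewrite mxE [RHS]mxE [X in _ = _ * X]mxE.
have J1 := jet_ray (fpoly A a al j) x (delta_mx i ord0).
have J2 : jet (fun t => (fpoly A a al j).@[coordsv (x + t *: delta_mx i ord0)])
    (fpoly A a al j).@[coordsv x] (2 * dot (delta_mx i ord0) (A j *m x + a j)).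
  exists 1, (dot (delta_mx i ord0) (A j *m delta_mx i ord0))%:P.
  by split=> [|t]; rewrite !hornerC ?oner_neq0 // !mulr1 fpoly_line.
have [_] := jet_unique J1 J2.
rewrite (bigD1 i) //= big1 => [|k ki]; last by rewrite mxE (negPf ki) mulr0.
rewrite mxE !eqxx mulr1 addr0 => ->; congr (_ * _).
rewrite dotE (bigD1 i) //= big1 => [|k ki]; last by rewrite mxE (negPf ki) mul0r.
by rewrite mxE !eqxx mul1r addr0.
Qed.

Lemma SxE x : Sx A a al x = (fun u => exists2 l, Sed A l & u = x - Jmx A a x *m l).
Proof.
by apply/funext=> u; rewrite /Sx JacfE; apply/propext; split=> -[l Sl E]; exists l => //;
  move: E; rewrite -scalemxAl scalerA mulVf ?scale1r // pnatr_eq0.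
Qed.

(** Hence [-J] carries the directions with [d^T B(d) mu = 0], tangent to the determinantal
    hypersurface, to the hyperplane orthogonal to [d]. *)
Lemma dot_Jmx x d mu : (forall j, dot d (A j *m x + a j) = - 2^-1 * dot d (A j *m d)) ->
  dot d (Jmx A a x *m mu) = - 2^-1 * dot d (Bmx A d *m mu).
Proof.
move=> h.
have E (F : 'I_n -> 'cV[R]_n) : dot d ((\matrix_(i, j) F j i ord0) *m mu) =
    \sum_j mu j ord0 * dot d (F j).
  have -> : (\matrix_(i, j) F j i ord0) *m mu = \sum_j mu j ord0 *: F j.
    by apply/colP=> i; rewrite mxE summxE; apply: eq_bigr => j _; rewrite !mxE mulrC.
  rewrite /dot mulmx_sumr summxE; apply: eq_bigr => j _.
  by rewrite -scalemxAr mxE.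
rewrite /Jmx /Bmx (E (fun j => A j *m x + a j)) (E (fun j => A j *m d)) mulr_sumr.
by apply: eq_bigr => j _; rewrite h mulrCA.
Qed.

Variable d0 : 'cV[R]_n.
Hypotheses (dB0 : \det (Bmx A d0) != 0) (d0_neq0 : d0 != 0).
Hypotheses (ps0 : psd (pencil A (lamof A d0))).
Hypothesis ker0 : \det (pencil A (lamof A d0) + d0 *m d0^T) != 0.

Section AtPoint.
Variables (x d : 'cV[R]_n).
Hypotheses (dn0 : d != 0) (dJ : \det (Jmx A a x) != 0) (dB : \det (Bmx A d) != 0).
Hypothesis dker : \det (pencil A (lamof A d) + d *m d^T) != 0.
Hypothesis normal : forall j, dot d (A j *m x + a j) = - 2^-1 * dot d (A j *m d).

Let J := Jmx A a x.
Let lam := lamof A d.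
Let u := x - J *m lam.

Let Ju : J \in unitmx. Proof. by rewrite unitmxE unitfE. Qed.

Lemma pullback_vanishes (p : {mpoly R[n]}) : vanishes_on p (topbd (Sx A a al x)) ->
  exists2 q : {mpoly R[n]}, vanishes_on q (topbd (Sed A)) &
    forall l, q.@[coordsv l] = p.@[coordsv (x - J *m l)].
Proof.
move=> pv; have [q hq] := affine_comp p (- J) x.
have qE l : q.@[coordsv l] = p.@[coordsv (x - J *m l)] by rewrite hq mulNmx.
exists q => // l bd; rewrite qE; apply: pv; rewrite SxE.
exact: topbd_affine_fwd.
Qed.

Lemma algbd_point : algbd (Sx A a al x) u.
Proof.
move=> p /pullback_vanishes[q qv qE]; rewrite -qE.
exact: (vanishes_lamof As dB0 d0_neq0 ps0 ker0 qv dB).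
Qed.

(** Forwards, the determinant transported by the affine map vanishes on the boundary, and its
    derivative along [w] is a nonzero multiple of [dot d w]. Backwards, a polynomial vanishing on
    the boundary is pulled back and [gradient_lamof] applies. *)
Lemma tangent_algbd w : tangent_space (algbd (Sx A a al x)) u w <-> dot d w = 0.
Proof.
pose mu := - (invmx J *m w).
have wE : w = - (J *m mu) by rewrite mulmxN mulKVmx // opprK.
have lineE t : x - J *m (lam + t *: mu) = u + t *: w.
  by rewrite wE mulmxDr -scalemxAr opprD addrA scalerN.
have dw : dot d w = 2^-1 * dot d (Bmx A d *m mu).
  by rewrite [in LHS]wE dotNr dot_Jmx // mulNr opprK.
split=> [tw|dw0 p pv].
  have [D DE] : polyof (@cev R n) (fun l => \det (pencil A l)).
    apply: polyof_det; apply: polymxD; first by move=> *; apply: polyof_cev_cst.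
    apply: polymxN; apply: (@polymx_lcomb _ _ _ _ _ (fun=> A)); last exact: polymx_cev_id.
    by move=> j; move=> *; apply: polyof_cev_cst.
  have [p hp] := affine_comp D (- invmx J) (invmx J *m x).
  have pE v : p.@[coordsv v] = \det (pencil A (invmx J *m (x - v))).
    by rewrite hp DE /= mulNmx mulmxBr.
  have pv : vanishes_on p (algbd (Sx A a al x)).
    move=> v; apply=> v'; rewrite SxE pE => /(topbd_affine_bwd dJ).
    by case/(topbd_Sed_pencil As).
  have J1 := jet_ray p u w; rewrite (tw p pv) in J1.
  have J2 := jet_det_pencil As mu dn0 (pencil_lamof dB) dker.
  have J3 : jet (fun t => \det (pencil A (lam + t *: mu))) p.@[coordsv u] 0.
    apply: jet_ext J1 => t; rewrite pE -lineE; congr (\det (pencil _ _)).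
    by rewrite opprB addrC subrK mulKmx.
  have [_ /eqP] := jet_unique J2 J3.
  rewrite mulf_eq0 invr_eq0 expf_eq0 /= [X in _ || X]gt_eqF ?dot_gt0 // orbF oppr_eq0.
  by rewrite mulf_eq0 (negPf dker) /= lcomb_mul dw => /eqP ->; rewrite mulr0.
have pv' : vanishes_on p (topbd (Sx A a al x)) by move=> v bd; apply: pv => r; apply.
have [q qv qE] := pullback_vanishes pv'.
have g0 : \sum_(i < n) (mderiv i q).@[coordsv lam] * mu i ord0 = 0.
  apply: (gradient_lamof As dB0 d0_neq0 ps0 ker0) => //.
  by move/eqP: dw0; rewrite dw mulf_eq0 invr_eq0 pnatr_eq0 /= => /eqP.
have J1 := jet_ray q lam mu; rewrite g0 in J1.
have J2 := jet_ray p u w.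
have J3 : jet (fun t => q.@[coordsv (lam + t *: mu)]) p.@[coordsv u]
    (\sum_(i < n) (mderiv i p).@[coordsv u] * w i ord0).
  by apply: jet_ext J2 => t; rewrite qE lineE.
by have [_ <-] := jet_unique J1 J3.
Qed.

End AtPoint.

(** The difference of squared distances is affine and serves as test polynomial; conversely
    [u + t w] stays on the bisector. *)
Lemma tangent_bisector x x' u w : bisector x x' u ->
  tangent_space (bisector x x') u w <-> dot (x' - x) w = 0.
Proof.
have sqE v : sqnorm (v - x) - sqnorm (v - x') = 2 * dot (x' - x) v + dot x x - dot x' x'.
  rewrite !sqnormE !(dotDl, dotDr, dotNl, dotNr) [dot v x]dotC [dot v x']dotC; ring.
move=> bu; have bv t : sqnorm (u + t *: w - x) - sqnorm (u + t *: w - x') = 2 * dot (x' - x) w * t.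
  have := sqE u; rewrite bu subrr => E.
  by rewrite sqE dotDr dotZr; have := E; lra.
split=> [tw|dw p pv].
  have [p pE] : polyof (@cev R n) (fun v => 2 * dot (x' - x) v + (dot x x - dot x' x')).
    apply: polyofD; last exact: polyof_cev_cst.
    apply: polyofM; first exact: polyof_cev_cst.
    by apply: polymxM; [move=> *; apply: polyof_cev_cst | apply: polymx_cev_id].
  have pE' v : p.@[coordsv v] = sqnorm (v - x) - sqnorm (v - x').
    by rewrite sqE -addrA pE.
  have pv : vanishes_on p (bisector x x') by move=> v bv'; rewrite pE' bv' subrr.
  have J1 := jet_ray p u w; rewrite (tw p pv) in J1.
  have J2 : jet (fun t => p.@[coordsv (u + t *: w)]) 0 (2 * dot (x' - x) w).
    by apply: jet_ext (jet_line 0 (2 * dot (x' - x) w)) => t; rewrite pE' bv add0r.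
  have [_] := jet_unique J1 J2.
  by move/esym/eqP; rewrite mulf_eq0 pnatr_eq0 /= => /eqP.
have [] // := jet_eq0 (jet_ray p u w) ltr01.
move=> t _ _; apply: pv; apply/eqP; by rewrite -subr_eq0 bv dw mulr0 mul0r.
Qed.

End Tangency.

(** Pairing a kernel vector of [M + d d^T] with [d] shows that it is orthogonal to [d] and killed by
    [M], whatever the scaling of [M]. *)
Lemma det_outer_scale (R : realType) (n : nat) (M : 'M[R]_n) (d : 'cV[R]_n) c :
  M^T = M -> M *m d = 0 -> d != 0 ->
  \det (c *: M + d *m d^T) != 0 -> \det (M + d *m d^T) != 0.
Proof.
move=> Ms Md dn0 dc; apply/eqP => /det_eq0_kernel[w w0].
rewrite mulmxDl dot_outer => E.
have dw : dot d w = 0.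
  have := congr1 (dot d) E; rewrite dotDr dot_trmx Ms Md [dot 0 w]dotC !dot0r add0r dotZr => /eqP.
  by rewrite mulf_eq0 [X in _ || X]gt_eqF ?dot_gt0 // orbF => /eqP.
rewrite dw scale0r addr0 in E.
by case/eqP: w0; apply: (det_neq0_inj dc); rewrite mulmxDl -scalemxAl E dot_outer dw scale0r scaler0 addr0.
Qed.

(** On the axis of index [o] the boundary is reached at some [t e_o]; kernel vectors there are
    eigenvectors of [A o] for [t^-1], to which the generic conditions apply. *)
Lemma exists_boundary_kernel (R : realType) (n : nat) (A : 'I_n -> 'M[R]_n) (o : 'I_n) :
  (forall i, (A i)^T = A i) ->
  (forall theta (e : 'cV[R]_n) l, e l ord0 = 1 -> A o *m e = theta *: e ->
    \det (Bmx A e) != 0 /\ \det (theta%:M - A o + e *m e^T) != 0) ->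
  exists d0 : 'cV[R]_n, [/\ \det (Bmx A d0) != 0, d0 != 0, psd (pencil A (lamof A d0)) &
    \det (pencil A (lamof A d0) + d0 *m d0^T) != 0].
Proof.
move=> As gen.
have Bo (e : 'cV[R]_n) : Bmx A e *m delta_mx o ord0 = A o *m e.
  have -> : Bmx A e *m delta_mx o ord0 = col o (Bmx A e) by rewrite colE.
  by apply/colP=> i; rewrite !mxE.
have delta0 : delta_mx o ord0 != 0 :> 'cV[R]_n.
  by apply/eqP => /(congr1 (fun w : 'cV[R]_n => w o ord0)) /eqP; rewrite !mxE !eqxx oner_eq0.
have Ao : A o != 0.
  apply/eqP => A0; have [||dB _] := gen 0 (delta_mx o ord0) o; first by rewrite mxE !eqxx.
    by rewrite A0 mul0mx scale0r.
  by case/eqP: delta0; apply: (det_neq0_inj dB); rewrite Bo A0 mul0mx.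
have [t ps /det_eq0_kernel[v v0]] := critical_pencil (As o) Ao.
rewrite mulmxBl mul1mx -scalemxAl => /subr0_eq vE.
have t0 : t != 0 by apply: contraNneq v0 => t0; rewrite vE t0 scale0r.
have [l vl] : exists l, v l ord0 != 0.
  apply/existsP; apply: contraNT v0 => /existsPn v0; apply/eqP/colP=> i.
  by rewrite mxE; apply/eqP; rewrite -[_ == _]negbK v0.
pose e := (v l ord0)^-1 *: v.
have el : e l ord0 = 1 by rewrite mxE mulVf.
have eE : t *: (A o *m e) = e by rewrite /e -scalemxAr scalerA mulrC -scalerA -vE.
have Ae : A o *m e = t^-1 *: e by rewrite -[in RHS]eE scalerA mulVf // scale1r.
have [dB dk] := gen _ _ _ el Ae.
have e0 : e != 0 by apply: contra_eq_neq el => ->; rewrite mxE eq_sym oner_neq0.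
have lE : lamof A e = t *: delta_mx o ord0.
  by apply/esym; apply: lamof_unique => //; rewrite -scalemxAr Bo.
have pE : pencil A (lamof A e) = 1%:M - t *: A o.
  rewrite lE /pencil lcombZ /lcomb (bigD1 o) //= mxE !eqxx scale1r big1 ?addr0 // => j jo.
  by rewrite mxE (negPf jo) scale0r.
exists e; split=> //; first by rewrite pE.
apply: (@det_outer_scale _ _ _ _ t^-1); rewrite ?pencil_tr ?pencil_lamof //.
by rewrite pE scalerBr scalerA mulVf // scale1r scalemx1.
Qed.

(* Genericity: there is a polynomial P in the coefficients of the data, not
   identically zero on the space of admissible data (A_i symmetric), such that
   the conclusion holds whenever P does not vanish at the data. *)
Theorem theorem4p5 (R : realType) (n : nat) :
  exists P : {mpoly R[#|{: coefT n}|]},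
    (exists (A0 : 'I_n -> 'M[R]_n) (a0 : 'I_n -> 'cV[R]_n) (al0 : 'I_n -> R),
        (forall i, (A0 i)^T = A0 i) /\ P.@[coords A0 a0 al0] != 0) /\
    (forall (A : 'I_n -> 'M[R]_n) (a : 'I_n -> 'cV[R]_n) (al : 'I_n -> R),
        (forall i, (A i)^T = A i) ->
        P.@[coords A a al] != 0 ->
        forall x x' : 'cV[R]_n,
          Vf A a al x -> Vf A a al x' -> x != x' ->
          exists u : 'cV[R]_n,
            meet_tangentially (bisector x x')
              (algbd (Sx A a al x)) (algbd (Sx A a al x')) u).
Proof.
(* In dimension zero no two points are distinct; otherwise index [0] can play the role of [o]. *)
case: n => [|n].
  exists 1; split=> [|A a al _ _ x x' _ _].
    by exists (fun=> 0), (fun=> 0), (fun=> 0); split=> [i|]; rewrite ?trmx0 // meval1 oner_neq0.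
  by case/eqP; apply/colP=> -[].
have [P [P0 genP]] := @generic_data R n.+1 ord0.
exists P; split=> // A a al As Pn x x' Vx Vx' xx'.
have [gen /(exists_boundary_kernel As)[d0 [dB0 d0n ps0 ker0]]] := genP A a al As Pn.
have chord y y' : Vf A a al y -> Vf A a al y' -> forall j,
    dot (y' - y) (A j *m y + a j) = - 2^-1 * dot (y' - y) (A j *m (y' - y)).
  move=> Vy Vy' j; have := fpoly_line a al As j y (y' - y) 1.
  by rewrite scale1r addrC subrK Vy Vy' expr1n !mul1r !mulr1; lra.
have gen' y y' : Vf A a al y -> Vf A a al y' -> y != y' ->
    [/\ \det (Jmx A a y) != 0, \det (Bmx A (y' - y)) != 0 &
        \det (pencil A (lamof A (y' - y)) + (y' - y) *m (y' - y)^T) != 0].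
  move=> Vy Vy' yy'; have dn0 : y' - y != 0 by rewrite subr_eq0 eq_sym.
  case: (gen y (y' - y) dn0).
  - by move=> j; have := Vy j; rewrite fpolyE /dot mulmxA.
  - by move=> j; have := chord _ _ Vy Vy' j; rewrite /dot -mulmxA; lra.
  move=> dJ dB dk; split=> //.
  apply: (@det_outer_scale _ _ _ _ (\det (Bmx A (y' - y)))); rewrite ?pencil_tr ?pencil_lamof //.
  by move: dk; rewrite /corank1_mx lamof_adj // lcombZ /pencil scalerBr scalemx1.
have [dJ dB dk] := gen' x x' Vx Vx' xx'.
have x'x : x' != x by rewrite eq_sym.
have [dJ' dB' dk'] := gen' x' x Vx' Vx x'x.
pose lam := lamof A (x' - x).
(* [B(d) lam = d] is homogeneous in [d], so exchanging the two points keeps the same [lam]. *)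
have lam' : lamof A (x - x') = lam.
  apply/esym; apply: lamof_unique => //.
  by rewrite -opprB -scaleN1r BmxZ -scalemxAl lamofE // scaleN1r opprB.
pose u := x - Jmx A a x *m lam.
(* [J(x') - J(x) = B(x' - x)], so both affine maps send [lam] to the same point [u]. *)
have JD : Jmx A a x' *m lam = Jmx A a x *m lam + (x' - x).
  rewrite -[X in _ + X](lamofE dB) -mulmxDl; congr (_ *m _).
  have JE y i j : Jmx A a y i j = (A j *m y) i ord0 + a j i ord0 by rewrite [LHS]mxE [LHS]mxE.
  have BE y i j : Bmx A y i j = (A j *m y) i ord0 by rewrite [LHS]mxE.
  apply/matrixP=> i j; rewrite [RHS]mxE !JE BE mulmxBr.
  by move: (A j *m x) (A j *m x') => y y'; rewrite !mxE; ring.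
have uE : u = x' - Jmx A a x' *m lam.
  by rewrite JD /u opprD opprB addrA addrAC; apply/colP=> i; rewrite !mxE; ring.
have bu : bisector x x' u.
  (* Along [x' - x] the displacement from [x] to [u] is half the chord, which puts [u] on the
     bisector. *)
  have h : dot (x' - x) (Jmx A a x *m lam) = - 2^-1 * dot (x' - x) (x' - x).
    by rewrite (dot_Jmx _ (chord _ _ Vx Vx')) lamofE.
  rewrite /bisector !sqnormE [in RHS]uE /u [x - _]addrC [x' - _]addrC !addrK JD.
  move: (Jmx A a x *m lam) (x' - x) h => y d h.
  by rewrite !(dotNl, dotNr, dotDl, dotDr) [dot y d]dotC h; lra.
have dn0 : x' - x != 0 by rewrite subr_eq0.
have dn0' : x - x' != 0 by rewrite subr_eq0.
have T := tangent_algbd al As dB0 d0n ps0 ker0 dn0 dJ dB dk (chord _ _ Vx Vx').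
have T' := tangent_algbd al As dB0 d0n ps0 ker0 dn0' dJ' dB' dk' (chord _ _ Vx' Vx).
exists u; split=> //.
- exact: (algbd_point As dB0 d0n ps0 ker0 dJ dB).
- by rewrite uE -lam'; apply: (algbd_point As dB0 d0n ps0 ker0 dJ' dB').
- by move=> w; apply: iff_trans (tangent_bisector w bu) (iff_sym (T w)).
- move=> w; apply: iff_trans (tangent_bisector w bu) _.
  rewrite uE -lam'; apply: iff_trans (iff_sym (T' w)).
  by rewrite -[x - x']opprB dotNl; split=> [->|/eqP]; rewrite ?oppr0 // oppr_eq0 => /eqP.
Qed.
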